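(* Let $0<R_1<R_2$, $L>0$, $h(\theta)=c(1+\epsilon\cos\theta)$ with $c>0$, $0<\epsilon<1$, and let $k_1,k_2,k_3$ be the positive constants given in the context. Then the porous journal bearing problem with cavitation (unilateral condition $p\ge0$ on $C_2$) has one and only one weak solution: with $\mathcal K=\{v\in H^1_{00}(Q):\ v\ge0\text{ on }C_2\}$, there exists a unique $u\in\mathcal K$ such that $$a(u,v-u)\ge\langle f,v-u\rangle\qquad\text{for all } v\in\mathcal K,$$ where $H^1_{00}(Q)$, $C_2$, $a$ and $f$ are as defined in the context.
   Context: Cylindrical coordinates $(\rho,\theta,y)$ are used; $Q=\{R_1<\rho<R_2,\ 0<\theta\le2\pi,\ 0<y<L\}$ and $C_2=\{\rho=R_2,\ 0<\theta\le 2\pi,\ 0<y<L\}$. The constants are $k_1=\frac{c^2}{12\Phi R_2^2}$, $k_2=\frac{c^2}{12L^2\Phi}$, $k_3=\frac{6U\mu}{12\Phi R_2}$ with $\Phi,U,\mu>0$ given constants. Let $\mathcal H$ be the set of $C^\infty$ functions $v(\rho,\theta,y)$ on $\bar Q$, $2\pi$-periodic in $\theta$ (i.e. smooth on $[R_1,R_2]\times\mathbb R\times[0,L]$ and $2\pi$-periodic in $\theta$), taking arbitrary values on $C_2$ and vanishing in a neighbourhood of the remaining part of the boundary, i.e. near $\rho=R_1$, $y=0$ and $y=L$. $H^1_{00}(Q)$ is the completion of $\mathcal H$ with respect to the norm $$\|v\|=\Big\{\int_0^{2\pi}\!\int_{R_1}^{R_2}\!\int_0^L\Big[v_\rho^2+\tfrac1{\rho^2}v_\theta^2+v_y^2\Big]\rho\,dy\,d\rho\,d\theta+\int_0^{2\pi}\!\int_0^L\big[k_1v_\theta^2(R_2,\theta,y)+k_2v_y^2(R_2,\theta,y)\big]R_2\,dy\,d\theta\Big\}^{1/2}.$$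 The restriction $v\mapsto v(R_2,\cdot,\cdot)$ extends continuously from $\mathcal H$ to a trace map $H^1_{00}(Q)\to L^2((0,2\pi)\times(0,L))$; ''$v\ge0$ on $C_2$'' means that the trace is $\ge0$ almost everywhere. The bilinear form and the functional (given here for $u,v\in\mathcal H$ and extended by continuity to $H^1_{00}(Q)$) are $$a(u,v)=\int_0^{2\pi}\!\int_{R_1}^{R_2}\!\int_0^L\Big[u_\rho v_\rho+\tfrac1{\rho^2}u_\theta v_\theta+u_yv_y\Big]\rho\,dy\,d\rho\,d\theta+\int_0^{2\pi}\!\int_0^Lh^3(\theta)\big[k_1u_\theta v_\theta+k_2u_yv_y\big](R_2,\theta,y)\,R_2\,dy\,d\theta,$$ $$\langle f,v\rangle=\int_0^{2\pi}\!\int_0^Lk_3h'(\theta)v(R_2,\theta,y)\,R_2\,dy\,d\theta.$$ *)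

(* Defs.v *)
From HB Require Import structures.
From mathcomp Require Import all_boot all_order all_algebra.
From mathcomp Require Import generic_quotient ring_quotient.
From mathcomp Require Import all_classical all_reals all_analysis measurable_realfun.
From mathcomp Require Import ring lra.

Set Implicit Arguments.
Unset Strict Implicit.
Unset Printing Implicit Defensive.

Import Order.TTheory GRing.Theory Num.Theory.
Import numFieldNormedType.Exports.

Local Open Scope classical_set_scope.
Local Open Scope ring_scope.

(* Points of space are triples x = (rho, theta, y) : R * R * R, so that
   x.1.1 = rho, x.1.2 = theta and x.2 = y; points of the surface rho = R2 are
   pairs z = (theta, y). *)

Notation area R := (@lebesgue_measure R \x @lebesgue_measure R)%E.
Notation volume R := (area R \x @lebesgue_measure R)%E.

Section calculus.
Context {R : realType}.
Implicit Types (u v : R * R * R -> R) (x : R * R * R).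

Definition d_rho v x : R := derive1 (fun s : R => v (s, x.1.2, x.2)) x.1.1.
Definition d_theta v x : R := derive1 (fun s : R => v (x.1.1, s, x.2)) x.1.2.
Definition d_y v x : R := derive1 (fun s : R => v (x.1.1, x.1.2, s)) x.2.

Definition has_partials v := forall x,
  [/\ derivable (fun s : R => v (s, x.1.2, x.2)) x.1.1 1,
      derivable (fun s : R => v (x.1.1, s, x.2)) x.1.2 1 &
      derivable (fun s : R => v (x.1.1, x.1.2, s)) x.2 1].

Fixpoint Ck (k : nat) v : Prop :=
  continuous v /\
  if k is k'.+1 then
    has_partials v /\ [/\ Ck k' (d_rho v), Ck k' (d_theta v) & Ck k' (d_y v)]
  else True.

Definition Cinfty v := forall k, Ck k v.

Lemma partials0 : [/\ d_rho 0 = 0, d_theta 0 = 0 & d_y 0 = 0].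
Proof. by split; apply/funext => x; exact: derive1_cst. Qed.

Lemma Ck0 k : Ck k 0.
Proof.
have [e1 e2 e3] := partials0.
elim: k => [|k IH]; split => //; try exact: cst_continuous.
by split; [move=> x; split; exact: derivable_cst | rewrite e1 e2 e3].
Qed.

Lemma partialsB u v : has_partials u -> has_partials v ->
  [/\ d_rho (u - v) = d_rho u - d_rho v,
      d_theta (u - v) = d_theta u - d_theta v & d_y (u - v) = d_y u - d_y v].
Proof.
move=> pu pv; split; apply/funext => x; have [u1 u2 u3] := pu x;
  have [v1 v2 v3] := pv x.
- change (d_rho (u - v) x = d_rho u x - d_rho v x).
  by have := deriveB u1 v1; rewrite /d_rho 3!derive1E.
- change (d_theta (u - v) x = d_theta u x - d_theta v x).
  by have := deriveB u2 v2; rewrite /d_theta 3!derive1E.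
- change (d_y (u - v) x = d_y u x - d_y v x).
  by have := deriveB u3 v3; rewrite /d_y 3!derive1E.
Qed.

Lemma CkB k u v : Ck k u -> Ck k v -> Ck k (u - v).
Proof.
elim: k u v => [|k IH] u v [cu hu] [cv hv].
  by split=> // x; apply: cvgB; [exact: cu|exact: cv].
split; first by move=> x; apply: cvgB; [exact: cu|exact: cv].
case: hu => pu [u1 u2 u3]; case: hv => pv [v1 v2 v3]; split.
  move=> x; have [u1' u2' u3'] := pu x; have [v1' v2' v3'] := pv x; split.
  - exact: (derivableB u1' v1').
  - exact: (derivableB u2' v2').
  - exact: (derivableB u3' v3').
by have [-> -> ->] := partialsB pu pv; split; exact: IH.
Qed.

Lemma Cinfty_partials v : Cinfty v -> has_partials v.
Proof. by move=> /(_ 1%N) [_ []]. Qed.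

Lemma Cinfty_continuous v : Cinfty v ->
  [/\ continuous v, continuous (d_rho v), continuous (d_theta v) &
      continuous (d_y v)].
Proof. by move=> /(_ 1%N) [? [_ [[? _] [? _] [? _]]]]. Qed.

Definition rbox (q : rat * rat * rat * nat) : set (R * R * R) :=
  ball (ratr q.1.1.1 : R) q.2.+1%:R^-1 `*` ball (ratr q.1.1.2 : R) q.2.+1%:R^-1
  `*` ball (ratr q.1.2 : R) q.2.+1%:R^-1.

Lemma jb_mball (a e : R) : measurable (ball a e).
Proof. by apply: open_measurable; exact: ball_open. Qed.

Lemma open_measurable3 (A : set (R * R * R)) : open A -> measurable A.
Proof.
move=> oA.
have -> : A = \bigcup_q (if `[< rbox q `<=` A >] then rbox q else set0).
  apply/seteqP; split=> [p Ap|p [q _]]; last first.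
    by case: ifPn => // /asboolP; exact.
  have /nbhs_ballP[e /= e0 pe] := open_nbhs_nbhs (conj oA Ap).
  have [n n_e] : exists n : nat, n.+1%:R^-1 < e / 2.
    have /cvgrPdist_lt/(_ (e / 2)) := @cvg_harmonic R.
    rewrite divr_gt0// => /(_ isT)[N _ /(_ N (leqnn N))] /=.
    by rewrite sub0r normrN ger0_norm// => ?; exists N.
  have near (a : R) : exists q : rat, ball (ratr q : R) n.+1%:R^-1 a.
    have [|q] := @rat_in_itvoo _ (a - n.+1%:R^-1) (a + n.+1%:R^-1).
      by rewrite ltrBlDr -addrA ltrDl addr_gt0.
    rewrite in_itv /= => /andP[q1 q2]; exists q; rewrite /ball /= ltr_norml.
    by rewrite ltrBrDr ltrBlDr addrC q1 addrC q2.
  have [q1 b1] := near p.1.1; have [q2 b2] := near p.1.2.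
  have [q3 b3] := near p.2.
  exists (q1, q2, q3, n) => //; case: ifPn => [_|/asboolP]; first by split.
  case=> x [[x1 x2] x3]; apply: pe.
  have tri (a b q : R) : ball q n.+1%:R^-1 a -> ball q n.+1%:R^-1 b -> ball a e b.
    move=> qa qb; apply: (@le_ball _ _ a (n.+1%:R^-1 + n.+1%:R^-1)).
      by rewrite [leRHS]splitr ltW// ltrD.
    by apply: (@ball_triangle _ _ q) => //; exact: ball_sym.
  by split; first split; apply: tri; eauto.
apply: countable_bigcupT_measurable; first exact: countableP.
move=> q; case: ifP => // _; apply: measurableX; last exact: jb_mball.
by apply: measurableX; exact: jb_mball.
Qed.

Lemma continuous_measurable3 v : continuous v -> measurable_fun setT v.
Proof.
move=> /continuousP cv; apply: (measurability _ (RGenOpens.measurableE R)).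
move=> _ [_ [a [b ->] <-]]; rewrite setTI.
by apply: open_measurable3; apply: cv; exact: interval_open.
Qed.
End calculus.

(* visc is the viscosity, written mu in the constant k3. *)
Record bearing (R : realType) := Bearing {
  jb_R1 : R; jb_R2 : R; jb_L : R;
  jb_c : R; jb_eps : R;
  jb_Phi : R; jb_U : R; jb_visc : R;
  R1_gt0 : 0 < jb_R1;
  R1_lt_R2 : jb_R1 < jb_R2;
  L_gt0 : 0 < jb_L;
  c_gt0 : 0 < jb_c;
  eps_gt0 : 0 < jb_eps;
  eps_lt1 : jb_eps < 1;
  Phi_gt0 : 0 < jb_Phi;
  U_gt0 : 0 < jb_U;
  visc_gt0 : 0 < jb_visc }.

Section bearing_theory.
Context {R : realType} (B : bearing R).
Local Notation R1 := (jb_R1 B).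
Local Notation R2 := (jb_R2 B).
Local Notation L := (jb_L B).
Local Notation c := (jb_c B).
Local Notation eps := (jb_eps B).
Local Notation Phi := (jb_Phi B).
Local Notation U := (jb_U B).
Local Notation visc := (jb_visc B).

Local Notation mR := (measurableTypeR R).

Definition k1 : R := c ^+ 2 / (12 * Phi * R2 ^+ 2).
Definition k2 : R := c ^+ 2 / (12 * L ^+ 2 * Phi).
Definition k3 : R := 6 * U * visc / (12 * Phi * R2).

Definition film (theta : R) : R := c * (1 + eps * cos theta).

Definition Q : set (mR * mR * mR) :=
  `]R1, R2[%classic `*` `]0, 2 * pi]%classic `*` `]0, L[%classic.

(* The part rho = R2 of the boundary, in the coordinates (theta, y). *)
Definition C2 : set (mR * mR) := `]0, 2 * pi]%classic `*` `]0, L[%classic.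

Definition closed_domain : set (R * R * R) :=
  `[R1, R2]%classic `*` setT `*` `[0, L]%classic.

(* The space of test functions. Smoothness on the closed domain
   [R1, R2] x R x [0, L] is smoothness of an extension to R^3, and v stands for
   such an extension: the values of v off the closed domain are never used, and
   two extensions of the same function are at distance 0 for Hnorm, hence
   identified in the completion. By periodicity, one width d serves for all
   theta in the condition that v vanishes near rho = R1, y = 0 and y = L. *)
Definition admissible (v : R * R * R -> R) : Prop :=
  [/\ Cinfty v,
      (forall x, closed_domain x -> v (x.1.1, x.1.2 + 2 * pi, x.2) = v x) &
      exists2 d : R, 0 < d & forall x, closed_domain x ->
        x.1.1 < R1 + d \/ x.2 < d \/ L - d < x.2 -> v x = 0].

Definition admissible_pred : {pred R * R * R -> R} :=
  fun v => `[< admissible v >].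

Lemma admissible_zmod_closed : zmod_closed admissible_pred.
Proof.
split=> [|u v].
  by apply/asboolP; split=> [k| |]; [exact: Ck0| | exists 1].
move=> /asboolP[su pu [d d0 du]] /asboolP[sv pv [e e0 ev]]; apply/asboolP; split.
- by move=> k; exact: CkB.
- by move=> x Dx; rewrite [LHS]/(_ - _) [RHS]/(_ - _) pu// pv.
- exists (Num.min d e); first by rewrite lt_min d0.
  move=> x Dx hx.
  have hd d' : Num.min d e <= d' ->
      x.1.1 < R1 + d' \/ x.2 < d' \/ L - d' < x.2.
    move=> le_d'; case: hx => [h|[h|h]]; [left|right; left|right; right].
    - by apply: lt_le_trans h _; rewrite lerD2l.
    - exact: lt_le_trans h le_d'.
    - by apply: le_lt_trans h; rewrite lerD2l lerN2.
  have hmd : Num.min d e <= d by rewrite ge_min lexx.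
  have hme : Num.min d e <= e by rewrite ge_min lexx orbT.
  change (u x - v x = 0).
  by rewrite (du _ Dx (hd _ hmd)) (ev _ Dx (hd _ hme)) subrr.
Qed.

HB.instance Definition _ :=
  GRing.isZmodClosed.Build (R * R * R -> R) admissible_pred
    admissible_zmod_closed.

Record Hspace := HSpace {
  Hval :> R * R * R -> R;
  _ : Hval \in admissible_pred }.

HB.instance Definition _ := [isSub for Hval].
HB.instance Definition _ := [Choice of Hspace by <:].
HB.instance Definition _ := [SubChoice_isSubZmodule of Hspace by <:].

(* The triple integrals are taken with respect to the product Lebesgue measure
   d rho d theta dy, the weight rho being part of the integrand. *)
Definition Hnorm (v : R * R * R -> R) : R := Num.sqrt
  (\int[volume R]_(x in Q)
     ((d_rho v x ^+ 2 + (x.1.1 ^+ 2)^-1 * d_theta v x ^+ 2 + d_y v x ^+ 2)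
      * x.1.1) +
   \int[area R]_(z in C2)
     ((k1 * d_theta v (R2, z.1, z.2) ^+ 2 + k2 * d_y v (R2, z.1, z.2) ^+ 2)
      * R2)).

Definition bearing_form (u v : R * R * R -> R) : R :=
  \int[volume R]_(x in Q)
     ((d_rho u x * d_rho v x + (x.1.1 ^+ 2)^-1 * (d_theta u x * d_theta v x)
       + d_y u x * d_y v x) * x.1.1) +
  \int[area R]_(z in C2)
     (film z.1 ^+ 3 *
      (k1 * (d_theta u (R2, z.1, z.2) * d_theta v (R2, z.1, z.2)) +
       k2 * (d_y u (R2, z.1, z.2) * d_y v (R2, z.1, z.2))) * R2).

Definition bearing_load (v : R * R * R -> R) : R :=
  \int[area R]_(z in C2) (k3 * derive1 film z.1 * v (R2, z.1, z.2) * R2).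

Lemma measurable_Q : measurable Q.
Proof. by do 2?apply: measurableX; exact: measurable_itv. Qed.

Lemma measurable_C2 : measurable C2.
Proof. by apply: measurableX; exact: measurable_itv. Qed.

Lemma jb_leb_itv_fin (b1 b2 : bool) (p q : R) :
  (@lebesgue_measure R [set` Interval (BSide b1 p) (BSide b2 q)]
     \is a fin_num)%E.
Proof. by rewrite lebesgue_measure_itv; case: ifP. Qed.

Lemma jb_area_box_fin (b1 b2 b3 b4 : bool) (p q r s : R) :
  (area R ([set` Interval (BSide b1 p) (BSide b2 q)] `*`
           [set` Interval (BSide b3 r) (BSide b4 s)]) \is a fin_num)%E.
Proof.
rewrite product_measure1E; [|exact: measurable_itv|exact: measurable_itv].
by apply: fin_numM; exact: jb_leb_itv_fin.
Qed.

Lemma area_C2_fin : (area R C2 < +oo)%E.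
Proof. by rewrite -ge0_fin_numE//; exact: jb_area_box_fin. Qed.

Lemma volume_Q_fin : (volume R Q < +oo)%E.
Proof.
rewrite -ge0_fin_numE// product_measure1E; [|
  by apply: measurableX; exact: measurable_itv|exact: measurable_itv].
by apply: fin_numM; [exact: jb_area_box_fin|exact: jb_leb_itv_fin].
Qed.

Definition closed_box : set (R * R * R) :=
  `[R1, R2]%classic `*` `[0, 2 * pi]%classic `*` `[0, L]%classic.

Lemma bounded_on_box (F : R * R * R -> R) : continuous F ->
  exists M : R, forall x, closed_box x -> `|F x| <= M.
Proof.
move=> cF; have cD : compact closed_box.
  by do 2?apply: compact_setX; exact: segment_compact.
have /compact_bounded[M [_ bM]] : compact (F @` closed_box).
  by apply: continuous_compact => //; exact: continuous_subspaceT.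
exists (M + 1) => x Dx; apply: (bM (M + 1)); first by rewrite ltrDl.
by exists x.
Qed.

Lemma integrable_Q (F : R * R * R -> R) : continuous F ->
  (volume R).-integrable Q (EFin \o F).
Proof.
move=> cF; apply: measurable_bounded_integrable.
- exact: measurable_Q.
- exact: volume_Q_fin.
- exact: measurable_funTS (continuous_measurable3 cF).
have [M bM] := bounded_on_box cF.
exists M; split; first exact: num_real.
move=> N MN x [[/= x1 x2] x3]; apply: le_trans (ltW MN); apply: bM.
by split; [split|]; move: x1 x2 x3;
  rewrite /= !in_itv /= => /andP[? ?] /andP[? ?] /andP[? ?];
  apply/andP; split => //; exact: ltW.
Qed.
Lemma integrable_C2 (F : R * R * R -> R) : continuous F ->
  (area R).-integrable C2 (EFin \o (fun z => F (R2, z.1, z.2))).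
Proof.
move=> cF; apply: measurable_bounded_integrable.
- exact: measurable_C2.
- exact: area_C2_fin.
- apply: measurable_funTS.
  apply: (@measurableT_comp _ _ _ _ _ _ F _ (fun z : R * R => (R2, z.1, z.2))).
    exact: continuous_measurable3.
  apply: measurable_fun_pair; last exact: measurable_snd.
  by apply: measurable_fun_pair; [exact: measurable_cst|exact: measurable_fst].
have [M bM] := bounded_on_box cF.
exists M; split; first exact: num_real.
move=> N MN z [/= z1 z2]; apply: le_trans (ltW MN); apply: bM.
split; [split|]; rewrite /= in_itv /=.
- by rewrite lexx ltW// R1_lt_R2.
- by move: z1; rewrite /= in_itv /= => /andP[/ltW -> ->].
- by move: z2; rewrite /= in_itv /= => /andP[/ltW -> /ltW ->].
Qed.

Definition vol_density (v : R * R * R -> R) (x : R * R * R) : R :=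
  (d_rho v x ^+ 2 + (x.1.1 ^+ 2)^-1 * d_theta v x ^+ 2 + d_y v x ^+ 2) * x.1.1.

Definition surf_density (v : R * R * R -> R) (x : R * R * R) : R :=
  (k1 * d_theta v x ^+ 2 + k2 * d_y v x ^+ 2) * R2.

Lemma integrable_vol_density (v : R * R * R -> R) : Cinfty v ->
  (volume R).-integrable Q (EFin \o vol_density v).
Proof.
move=> /Cinfty_continuous[_ c1 c2 c3].
pose r (x : R * R * R) := Num.max x.1.1 R1.
have r0 x : 0 < r x by rewrite lt_max R1_gt0 orbT.
have cr : continuous r.
  move=> x; apply: (@continuous_max R _ (fun x => x.1.1) (fun=> R1)).
    apply: (@continuous_comp _ _ _ fst fst); exact: cvg_fst.
  exact: cvg_cst.
pose G x := (d_rho v x * d_rho v x + (r x * r x)^-1 * (d_theta v x * d_theta v x)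
  + d_y v x * d_y v x) * r x.
apply: (@eq_integrable _ _ _ (volume R) Q measurable_Q (EFin \o G)
  (EFin \o vol_density v)).
  move=> x /set_mem[[/= x1 _] _]; rewrite /G /vol_density /= /r.
  suff -> : Num.max x.1.1 R1 = x.1.1 by rewrite !expr2.
  by apply/max_idPl; move: x1; rewrite /= in_itv /= => /andP[/ltW].
apply: integrable_Q => x; apply: cvgM; last exact: cr.
apply: cvgD; last by apply: cvgM; exact: c3.
apply: cvgD; first by apply: cvgM; exact: c1.
apply: cvgM; last by apply: cvgM; exact: c2.
apply: cvgV; first by rewrite gt_eqF// mulr_gt0.
by apply: cvgM; exact: cr.
Qed.

Lemma integrable_surf_density (v : R * R * R -> R) : Cinfty v ->
  (area R).-integrable C2 (EFin \o (fun z => surf_density v (R2, z.1, z.2))).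
Proof.
move=> /Cinfty_continuous[_ _ c2 c3].
have sq (F : R * R * R -> R) : continuous F ->
    continuous (fun x : R * R * R => F x ^+ 2 : R).
  by move=> cF x; exact: (cvgM (cF x) (cF x)).
apply: integrable_C2 => x; apply: cvgM; last exact: cvg_cst.
by apply: cvgD; apply: cvgM; first [exact: cvg_cst|exact: sq].
Qed.

Lemma Hnorm_density v : Hnorm v = Num.sqrt
  (\int[volume R]_(x in Q) vol_density v x +
   \int[area R]_(z in C2) surf_density v (R2, z.1, z.2)).
Proof. by []. Qed.

Lemma k1_gt0 : 0 < k1.
Proof.
by rewrite divr_gt0 ?exprn_gt0 ?c_gt0// !mulr_gt0 ?Phi_gt0 ?exprn_gt0//
  (lt_trans (R1_gt0 B) (R1_lt_R2 B)).
Qed.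

Lemma k2_gt0 : 0 < k2.
Proof.
by rewrite divr_gt0 ?exprn_gt0 ?c_gt0// !mulr_gt0 ?Phi_gt0 ?exprn_gt0 ?L_gt0.
Qed.

Lemma jb_int2 d (T : measurableType d) (m : {measure set T -> \bar R}) (A : set T)
    (f : T -> R) : measurable A -> m.-integrable A (EFin \o f) ->
  m.-integrable A (EFin \o (fun x => 2 * f x)).
Proof.
move=> mA h.
have := @integrableZl _ _ _ m A mA 2 _ h.
by apply: eq_integrable => // x _; rewrite /= EFinM.
Qed.

Lemma jb_le_int2 d (T : measurableType d) (m : {measure set T -> \bar R})
    (A : set T) (f g h : T -> R) : measurable A ->
  m.-integrable A (EFin \o f) -> m.-integrable A (EFin \o g) ->
  m.-integrable A (EFin \o h) ->
  (forall x, A x -> f x <= 2 * g x + 2 * h x) ->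
  \int[m]_(x in A) f x <=
  2 * \int[m]_(x in A) g x + 2 * \int[m]_(x in A) h x.
Proof.
move=> mA jf jg jh fgh; rewrite -!RintegralZl// -RintegralD//; try exact: jb_int2.
apply: le_Rintegral => //.
have := @integrableD _ _ _ m A mA _ _ (jb_int2 mA jg) (jb_int2 mA jh).
by apply: eq_integrable => // x _; rewrite /= EFinD.
Qed.

Lemma jb_sqrB_le (a b : R) : (a - b) ^+ 2 <= 2 * a ^+ 2 + 2 * b ^+ 2.
Proof. by have := sqr_ge0 (a + b); rewrite -subr_ge0 => h; nra. Qed.

Lemma jb_surf_le (a b a' b' p q w : R) : 0 <= p -> 0 <= q -> 0 <= w ->
  (p * (a - a') ^+ 2 + q * (b - b') ^+ 2) * w <=
  2 * ((p * a ^+ 2 + q * b ^+ 2) * w) + 2 * ((p * a' ^+ 2 + q * b' ^+ 2) * w).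
Proof.
move=> p0 q0 w0; rewrite !(mulrA 2) -mulrDl ler_wpM2r//.
have h1 := ler_wpM2l p0 (jb_sqrB_le a a').
have h2 := ler_wpM2l q0 (jb_sqrB_le b b').
lra.
Qed.

Lemma jb_vol_le (a b s a' b' s' r w : R) : 0 <= r -> 0 <= w ->
  ((a - a') ^+ 2 + r * (b - b') ^+ 2 + (s - s') ^+ 2) * w <=
  2 * ((a ^+ 2 + r * b ^+ 2 + s ^+ 2) * w) +
  2 * ((a' ^+ 2 + r * b' ^+ 2 + s' ^+ 2) * w).
Proof.
move=> r0 w0; rewrite !(mulrA 2) -mulrDl ler_wpM2r//.
have h1 := jb_sqrB_le a a'.
have h2 := ler_wpM2l r0 (jb_sqrB_le b b').
have h3 := jb_sqrB_le s s'.
lra.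
Qed.

Lemma jb_addB_le (p q r s t w : R) : p <= 2 * q + 2 * r -> s <= 2 * t + 2 * w ->
  p + s <= 2 * (q + t) + 2 * (r + w).
Proof. by move=> h1 h2; rewrite !mulrDr addrACA lerD. Qed.

Lemma energyB_le (u v : R * R * R -> R) : Cinfty u -> Cinfty v ->
  \int[volume R]_(x in Q) vol_density (u - v) x +
  \int[area R]_(z in C2) surf_density (u - v) (R2, z.1, z.2) <=
  2 * (\int[volume R]_(x in Q) vol_density u x +
       \int[area R]_(z in C2) surf_density u (R2, z.1, z.2)) +
  2 * (\int[volume R]_(x in Q) vol_density v x +
       \int[area R]_(z in C2) surf_density v (R2, z.1, z.2)).
Proof.
move=> su sv; have suv : Cinfty (u - v) by move=> k; exact: CkB.
have [e1 e2 e3] := partialsB (Cinfty_partials su) (Cinfty_partials sv).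
have iu := integrable_vol_density su; have iv := integrable_vol_density sv.
have ju := integrable_surf_density su; have jv := integrable_surf_density sv.
apply: jb_addB_le.
- apply: (jb_le_int2 measurable_Q (integrable_vol_density suv) iu iv).
  move=> x [[/= x1 _] _].
  have x0 : 0 < x.1.1.
    move: x1; rewrite /= in_itv /= => /andP[h _].
    exact: lt_trans (R1_gt0 B) h.
  rewrite /vol_density e1 e2 e3; apply: jb_vol_le; last exact: ltW.
  by rewrite invr_ge0 sqr_ge0.
- apply: (jb_le_int2 measurable_C2 (integrable_surf_density suv) ju jv).
  move=> z _; rewrite /surf_density e2 e3; apply: jb_surf_le.
  - exact: ltW k1_gt0.
  - exact: ltW k2_gt0.
  - exact: ltW (lt_trans (R1_gt0 B) (R1_lt_R2 B)).
Qed.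

Lemma Hval_Cinfty (v : Hspace) : Cinfty v.
Proof. by case: v => v /= /asboolP[]. Qed.

Lemma Hnorm0 : Hnorm 0 = 0.
Proof.
have [e1 e2 e3] := @partials0 R.
rewrite Hnorm_density [X in X + _](_ : _ = 0) ?add0r.
  rewrite [X in Num.sqrt X](_ : _ = 0) ?sqrtr0//.
  rewrite /Rintegral integral0_eq//= => z _.
  by rewrite /surf_density e2 e3 !expr0n /= !mulr0 addr0 mul0r.
rewrite /Rintegral integral0_eq//= => x _.
by rewrite /vol_density e1 e2 e3 !expr0n /= mulr0 !addr0 mul0r.
Qed.

Lemma jb_half_lt (p q s e : R) : s <= 2 * p + 2 * q ->
  p < (e / 2) ^+ 2 -> q < (e / 2) ^+ 2 -> s < e ^+ 2.
Proof.
move=> h1 h2 h3; apply: le_lt_trans h1 _.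
have -> : e ^+ 2 = 2 * (e / 2) ^+ 2 + 2 * (e / 2) ^+ 2 by field.
by apply: ltrD; rewrite ltr_pM2l.
Qed.

Lemma HnormB_lt (u v : Hspace) (e : R) :
  Hnorm u < e / 2 -> Hnorm v < e / 2 -> Hnorm (u - v) < e.
Proof.
have sqrt_lt (a r : R) : 0 <= r -> Num.sqrt a < r -> a < r ^+ 2.
  move=> r0 ar; have [a0|a0] := leP 0 a.
    by rewrite -(sqr_sqrtr a0) ltr_pXn2r ?nnegrE ?sqrtr_ge0.
  exact: lt_le_trans (sqr_ge0 _).
move=> ue ve; have e20 : 0 < e / 2 by apply: le_lt_trans ue; exact: sqrtr_ge0.
have e0 : 0 < e by rewrite (splitr e) addr_gt0.
have -> : Hval (u - v) = Hval u - Hval v by [].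
have := energyB_le (Hval_Cinfty u) (Hval_Cinfty v).
move: ue ve; rewrite !Hnorm_density => /(sqrt_lt _ _ (ltW e20)) ue.
move=> /(sqrt_lt _ _ (ltW e20)) ve uv.
rewrite -[ltRHS](ger0_norm (ltW e0)) -sqrtr_sqr ltr_sqrt ?exprn_gt0//.
exact: jb_half_lt uv ue ve.
Qed.

(* The completion of the test functions for Hnorm: Cauchy sequences modulo the
   sequences whose norm tends to 0. *)
Definition cauchy_pred : {pred nat -> Hspace} := fun s =>
  `[< forall e : R, 0 < e -> exists N : nat, forall m n : nat,
        (N <= m)%N -> (N <= n)%N -> Hnorm (s m - s n) < e >].

Lemma cauchy_zmod_closed : zmod_closed cauchy_pred.
Proof.
split=> [|s t /asboolP cs /asboolP ct]; apply/asboolP => e e0.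
  exists 0%N => m n _ _; rewrite [X in Hval X](_ : _ = 0) ?Hnorm0//.
  exact: subrr.
have e20 : 0 < e / 2 by rewrite divr_gt0.
have [N1 h1] := cs _ e20; have [N2 h2] := ct _ e20.
exists (maxn N1 N2) => m n; rewrite !geq_max => /andP[m1 m2] /andP[n1 n2].
have -> : (s - t) m - (s - t) n = (s m - s n) - (t m - t n).
  by change (s m - t m - (s n - t n) = s m - s n - (t m - t n));
    rewrite !opprD addrACA.
by apply: HnormB_lt; [exact: h1|exact: h2].
Qed.

HB.instance Definition _ :=
  GRing.isZmodClosed.Build (nat -> Hspace) cauchy_pred cauchy_zmod_closed.

Record cauchyH := CauchyH {
  cauchy_val :> nat -> Hspace;
  _ : cauchy_val \in cauchy_pred }.

HB.instance Definition _ := [isSub for cauchy_val].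
HB.instance Definition _ := [Choice of cauchyH by <:].
HB.instance Definition _ := [SubChoice_isSubZmodule of cauchyH by <:].

Definition null_pred : {pred cauchyH} := fun s =>
  `[< Hnorm (s n) @[n --> \oo] --> (0 : R) >].

Lemma jb_cvg0_lt (a : nat -> R) (e : R) : a n @[n --> \oo] --> 0 -> 0 < e ->
  \forall n \near \oo, a n < e.
Proof.
move=> /cvgr0Pnorm_lt a0 e0; apply: filterS (a0 _ e0) => n.
exact: le_lt_trans (ler_norm _).
Qed.

Lemma jb_cvg0P (a : nat -> R) : (forall n, 0 <= a n) ->
  (forall e, 0 < e -> \forall n \near \oo, a n < e) -> a n @[n --> \oo] --> 0.
Proof.
move=> a0 h; apply/cvgr0Pnorm_lt => e e0; apply: filterS (h _ e0) => n.
by rewrite ger0_norm.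
Qed.

Lemma null_zmod_closed : zmod_closed null_pred.
Proof.
split=> [|s t /asboolP cs /asboolP ct]; apply/asboolP.
  have -> : (fun n => Hnorm ((0 : cauchyH) n)) = fun=> 0.
    by apply/funext => n; exact: Hnorm0.
  exact: cvg_cst.
apply: jb_cvg0P => [n|e e0]; first exact: sqrtr_ge0.
have e20 : 0 < e / 2 by rewrite divr_gt0.
apply: filterS2 (jb_cvg0_lt cs e20) (jb_cvg0_lt ct e20) => n.
exact: (@HnormB_lt (s n) (t n)).
Qed.

HB.instance Definition _ :=
  GRing.isZmodClosed.Build cauchyH null_pred null_zmod_closed.

Definition H100 := {ideal_quot null_pred}.
HB.instance Definition _ := GRing.Zmodule.on H100.

(* A Cauchy sequence of test functions representing v. The limits below do not
   depend on its choice, bearing_form, bearing_load and the restriction to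
   rho = R2 (with values in L^2 (C2)) being continuous for Hnorm. *)
Definition approx (v : H100) : nat -> Hspace := repr v.

Definition form_ext (u v : H100) : R :=
  limn (fun n => bearing_form (approx u n) (approx v n)).

Definition load_ext (v : H100) : R := limn (fun n => bearing_load (approx v n)).

(* g represents the trace of v, i.e. the limit in L^2 (C2) of the restrictions
   of the approximating test functions. *)
Definition is_trace (v : H100) (g : mR * mR -> R) : Prop :=
  [/\ measurable_fun C2 g,
      (\int[area R]_(z in C2) (g z ^+ 2)%:E < +oo)%E &
      (\int[area R]_(z in C2) ((approx v n (R2, z.1, z.2) - g z) ^+ 2)%:E)%E
        @[n --> \oo] --> 0%E].

Definition nonneg_on_C2 (v : H100) : Prop :=
  exists2 g, is_trace v g & {ae area R, forall z, C2 z -> 0 <= g z}.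

Definition Kset : set H100 := [set v | nonneg_on_C2 v].

End bearing_theory.

(* Main.v *)
From HB Require Import structures.
Require Import Defs.
From mathcomp Require Import all_boot all_order all_algebra.
From mathcomp Require Import generic_quotient ring_quotient.
From mathcomp Require Import all_classical all_reals all_analysis measurable_realfun.
From mathcomp Require Import ring lra.

(* Write J = a/2 - f for the energy and E(v) for the integral over C2 of the
   squared negative part of v. A class belongs to the cone K exactly when E tends
   to 0 along an approximating sequence of test functions. The penalized infima
   m_k = inf {J v : E v <= 1/(k+1)}, over test functions only, increase to a
   finite limit, and near-minimizers of the m_k form a Cauchy sequence by the
   parallelogram identity; its class is the solution, the inequality following
   from a one-sided first variation. Poincare's inequality on C2, obtained by
   integrating the y-derivative of y v^2 along vertical lines, bounds the trace
   and the load by the form, and the completeness of L^2 turns the convergence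
   of E into a nonnegative trace. *)

Set Implicit Arguments.
Unset Strict Implicit.
Unset Printing Implicit Defensive.

Import Order.TTheory GRing.Theory Num.Theory.
Import numFieldNormedType.Exports.

Local Open Scope classical_set_scope.
Local Open Scope ring_scope.

(** * Minimization of a quadratic energy under a limit constraint *)

(** Minimizing directly over K would call for the Hilbert space structure of the completion, where
    the form is only a limit along chosen representatives. The minimization therefore happens before
    completion, on sequences of test functions equipped with a semidefinite form. The cone has to be
    relaxed because positive parts leave the smooth class: a member of K comes with approximants
    whose negative parts merely tend to 0 in L^2. Convexity of the cone is replaced by two
    properties of E, namely E(u + v) <= 2 E(u) + 2 E(v) and E(t u) = t^2 E(u) for t >= 0: sublevel
    sets are then stable under midpoints, and a convex combination of two elements with E <= d/4 has
    E <= d. The load enters only through linearity and the one-sided bound f(v) <= C + a(v, v);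
    rescaling v turns this bound into continuity of f and into a lower bound for J. *)

Lemma cauchy_seq_cvg (R : realType) (x : nat -> R) :
  (forall e, 0 < e -> exists N : nat, forall m n : nat,
     (N <= m)%N -> (N <= n)%N -> `|x m - x n| <= e) -> cvgn x.
Proof.
move=> h; apply/cauchy_cvgP/cauchy_exP => e e0.
have e20 : 0 < e / 2 by rewrite divr_gt0.
have [N hN] := h _ e20; exists (x N), N => // n /= Nn.
by apply: le_lt_trans (hN N n (leqnn N) Nn) _; rewrite ltr_pdivrMr// ltr_pMr// ltr1n.
Qed.

Section form.
Context {R : realType} {V : lmodType R}.
Variables (a : V -> V -> R) (f E : V -> R) (C : R).
Hypothesis aC : forall u v, a u v = a v u.
Hypothesis aD : forall u v w, a (u + v) w = a u w + a v w.
Hypothesis aZ : forall t u w, a (t *: u) w = t * a u w.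
Hypothesis a_ge0 : forall v, 0 <= a v v.

Lemma formDr u v w : a w (u + v) = a w u + a w v.
Proof. by rewrite aC aD !(aC _ w). Qed.

Lemma formZr t u w : a w (t *: u) = t * a w u.
Proof. by rewrite aC aZ aC. Qed.

Lemma formN u w : a (- u) w = - a u w.
Proof. by rewrite -scaleN1r aZ mulN1r. Qed.

Lemma formNr u w : a w (- u) = - a w u.
Proof. by rewrite aC formN aC. Qed.

Let formE := (aD, formDr, formN, formNr, aZ, formZr).

Lemma form_sqB_le u v : a (u - v) (u - v) <= 2 * a u u + 2 * a v v.
Proof.
have := a_ge0 (u + v); rewrite !formE (aC v u); lra.
Qed.

(** The polynomial t -> a(u + t v, u + t v) is nonnegative. The form is only semidefinite, since
    distinct test functions may agree on the closed domain, so a(v, v) = 0 is a case of its own. *)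
Lemma form_CS u v : a u v ^+ 2 <= a u u * a v v.
Proof.
have h t : 0 <= a u u + 2 * t * a u v + t ^+ 2 * a v v.
  by have := a_ge0 (u + t *: v); rewrite !formE (aC v u); nra.
have [v0|v0] := eqVneq (a v v) 0.
  suff -> : a u v = 0 by rewrite v0 mulr0 expr0n.
  apply/eqP; apply/negPn/negP => n0.
  (* With a(v, v) = 0 the polynomial is affine in t, and this t gives it the value -1. *)
  have := h (- (a u u + 1) / (2 * a u v)).
  rewrite v0 mulr0 addr0.
  have -> : 2 * (- (a u u + 1) / (2 * a u v)) * a u v = - (a u u + 1) by field.
  lra.
have vp : 0 < a v v by rewrite lt_def v0 a_ge0.
(* The minimizer of the quadratic in t. *)
have := h (- a u v / a v v).
rewrite -(pmulr_rge0 _ vp).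
have -> : a v v * (a u u + 2 * (- a u v / a v v) * a u v
   + (- a u v / a v v) ^+ 2 * a v v) = a u u * a v v - a u v ^+ 2 by field.
by rewrite subr_ge0.
Qed.

Lemma form_small M e u v : 0 < M -> 0 < e -> a u u <= e ^+ 2 / M ->
  a v v <= M -> `|a u v| <= e.
Proof.
move=> M0 e0 hu hv; rewrite -(@ler_pXn2r _ 2%N isT) ?nnegrE//; last exact: ltW.
rewrite real_normK ?num_real//; apply: le_trans (form_CS u v) _.
by rewrite -[leRHS](divfK (lt0r_neq0 M0)) ler_pM.
Qed.

Definition form_cauchy (s : nat -> V) := forall e, 0 < e ->
  exists N : nat, forall m n : nat, (N <= m)%N -> (N <= n)%N ->
    a (s m - s n) (s m - s n) < e.

Lemma form_cauchyB s t : form_cauchy s -> form_cauchy t ->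
  form_cauchy (fun n => s n - t n).
Proof.
move=> cs ct e e0; have e4 : 0 < e / 4 by rewrite divr_gt0.
have [N1 h1] := cs _ e4; have [N2 h2] := ct _ e4.
exists (maxn N1 N2) => m n; rewrite !geq_max => /andP[m1 m2] /andP[n1 n2].
have -> : s m - t m - (s n - t n) = s m - s n - (t m - t n).
  by rewrite !opprD addrACA.
have := form_sqB_le (s m - s n) (t m - t n).
have := h1 _ _ m1 n1; have := h2 _ _ m2 n2; lra.
Qed.

Lemma form_cauchy_bounded s : form_cauchy s ->
  exists2 M, 0 < M & \forall n \near \oo, a (s n) (s n) <= M.
Proof.
move=> /(_ 1 ltr01)[N hN]; exists (2 + 2 * a (s N) (s N)).
  by have := a_ge0 (s N); lra.
exists N => // n /= Nn.
have := form_sqB_le (s n - s N) (- s N); rewrite opprK subrK formN formNr opprK.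
have := hN n N Nn (leqnn N); lra.
Qed.

Lemma form_null s w : form_cauchy s -> a (w n) (w n) @[n --> \oo] --> 0 ->
  a (s n) (w n) @[n --> \oo] --> 0.
Proof.
move=> cs w0; have [M M0 hM] := form_cauchy_bounded cs.
apply/cvgr0Pnorm_le => e e0.
have /cvgr0Pnorm_le/(_ (e ^+ 2 / M)) := w0.
rewrite divr_gt0 ?exprn_gt0// => /(_ isT); apply: filterS2 hM => n hM hw.
rewrite aC; apply: (form_small M0 e0) => //.
exact: le_trans (ler_norm _) hw.
Qed.

Lemma form_cvg s t : form_cauchy s -> form_cauchy t ->
  cvgn (fun n => a (s n) (t n)).
Proof.
move=> cs ct.
have [M1 M10 [N1 _ h1]] := form_cauchy_bounded cs.
have [M2 M20 [N2 _ h2]] := form_cauchy_bounded ct.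
apply: cauchy_seq_cvg => e e0.
have e20 : 0 < e / 2 by rewrite divr_gt0.
have [|N3 h3] := cs ((e / 2) ^+ 2 / M2); first by rewrite divr_gt0 ?exprn_gt0.
have [|N4 h4] := ct ((e / 2) ^+ 2 / M1); first by rewrite divr_gt0 ?exprn_gt0.
exists (maxn (maxn N1 N2) (maxn N3 N4)) => m n.
rewrite !geq_max => /andP[/andP[m1 m2] /andP[m3 m4]].
move=> /andP[/andP[n1 n2] /andP[n3 n4]].
have -> : a (s m) (t m) - a (s n) (t n) =
    a (s m - s n) (t m) + a (s n) (t m - t n) by rewrite !formE; ring.
apply: le_trans (ler_normD _ _) _; rewrite [leRHS]splitr; apply: lerD.
- by apply: (form_small M20) => //; [exact/ltW/h3 | exact: h2].
- by rewrite aC; apply: (form_small M10) => //; [exact/ltW/h4 | exact: h1].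
Qed.

(** [form_ext u (v - u)] is computed along the representative chosen for [v - u], which differs from
    the difference of the representatives of [v] and [u] by a null sequence; the limit does not see
    it. *)
Lemma form_lim_equiv s w w' : form_cauchy s -> form_cauchy w ->
  a (w' n - w n) (w' n - w n) @[n --> \oo] --> 0 ->
  limn (fun n => a (s n) (w' n)) = limn (fun n => a (s n) (w n)).
Proof.
move=> cs cw h; have := cvgD (form_cvg cs cw) (form_null cs h).
rewrite addr0 => cl; apply: cvg_lim => //.
have -> : (fun n => a (s n) (w' n)) =
    (fun n => a (s n) (w n)) + (fun n => a (s n) (w' n - w n)).
  apply/funext => n; change (a (s n) (w' n) = a (s n) (w n) + a (s n) (w' n - w n)).
  by rewrite -formDr addrC subrK.
exact: cl.
Qed.

(** * Linear loads with a one-sided quadratic bound *)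

Hypothesis fD : forall u v, f (u + v) = f u + f v.
Hypothesis fZ : forall t u, f (t *: u) = t * f u.
Hypothesis f_le : forall v, f v <= C + a v v.

Let C1 := `|C| + 1.
Let C1_gt0 : 0 < C1. Proof. by rewrite ltr_pwDr. Qed.

Lemma loadN u : f (- u) = - f u.
Proof. by rewrite -scaleN1r fZ mulN1r. Qed.

(** Applied to t w with t = 2 C1 / e, the inhomogeneous bound [f_le] reads t f(w) <= C + t^2 a(w, w)
    <= 2 C1. Taking w = v and w = - v controls the absolute value. *)
Lemma load_small e v : 0 < e -> a v v <= e ^+ 2 / (4 * C1) -> `|f v| <= e.
Proof.
move=> e0 hv.
have key w : a w w = a v v -> f w <= e.
  move=> wv; have := f_le ((2 * C1 / e) *: w); rewrite fZ !formE wv => h.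
  have CC : C <= C1 by rewrite ler_wpDr// ler_norm.
  have : 2 * C1 / e * f w <= 2 * C1.
    apply: le_trans h _.
    have := ler_wpM2l (_ : 0 <= (2 * C1 / e) ^+ 2) hv.
    rewrite sqr_ge0 => /(_ isT).
    have -> : (2 * C1 / e) ^+ 2 * (e ^+ 2 / (4 * C1)) = C1.
      by field; rewrite !gt_eqF.
    by rewrite expr2 -mulrA; lra.
  by rewrite mulrAC ler_pdivrMr// ler_pM2l// mulr_gt0.
rewrite ler_norml key// andbT lerNl -loadN key//.
by rewrite !formE opprK.
Qed.

Lemma load_null w : a (w n) (w n) @[n --> \oo] --> 0 ->
  f (w n) @[n --> \oo] --> 0.
Proof.
move=> w0; apply/cvgr0Pnorm_le => e e0.
have /cvgr0Pnorm_le/(_ (e ^+ 2 / (4 * C1))) := w0.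
rewrite divr_gt0 ?exprn_gt0 ?mulr_gt0// => /(_ isT); apply: filterS => n hw.
by apply: load_small => //; exact: le_trans (ler_norm _) hw.
Qed.

Lemma load_cvg s : form_cauchy s -> cvgn (fun n => f (s n)).
Proof.
move=> cs; apply: cauchy_seq_cvg => e e0.
have [|N h] := cs (e ^+ 2 / (4 * C1)).
  by rewrite divr_gt0 ?exprn_gt0 ?mulr_gt0.
exists N => m n Nm Nn; rewrite -loadN -fD; apply: load_small => //.
exact/ltW/h.
Qed.

Lemma load_lim_equiv w w' : form_cauchy w ->
  a (w' n - w n) (w' n - w n) @[n --> \oo] --> 0 ->
  limn (fun n => f (w' n)) = limn (fun n => f (w n)).
Proof.
move=> cw h; have := cvgD (load_cvg cw) (load_null h).
rewrite addr0 => cl; apply: cvg_lim => //.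
have -> : (fun n => f (w' n)) = (fun n => f (w n)) + (fun n => f (w' n - w n)).
  apply/funext => n; change (f (w' n) = f (w n) + f (w' n - w n)).
  by rewrite -fD addrC subrK.
exact: cl.
Qed.

(** * Near-minimizers under a vanishing constraint *)

Hypothesis E_ge0 : forall v, 0 <= E v.
Hypothesis E_D : forall u v, E (u + v) <= 2 * E u + 2 * E v.
Hypothesis EZ : forall t u, 0 <= t -> E (t *: u) = t ^+ 2 * E u.

Definition energy v := a v v / 2 - f v.

Lemma energy_ge v : - (2 * C) <= energy v.
Proof.
(* At v / 2 the bound [f_le], doubled, reads f(v) <= 2 C + a(v, v) / 2. *)
have := f_le (2^-1 *: v); rewrite fZ !formE /energy => h.
lra.
Qed.

(** The load cancels by linearity, which leaves the parallelogram identity. *)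
Lemma energy_mid u v :
  a (u - v) (u - v) =
  4 * (energy u + energy v - 2 * energy (2^-1 *: (u + v))).
Proof. by rewrite /energy !(formE, fD, fZ) (aC v u); field. Qed.

(** Homogeneity of degree two contributes 1/4, which absorbs the factor 2 of [E_D]. *)
Lemma E_mid u v : E (2^-1 *: (u + v)) <= (E u + E v) / 2.
Proof. by rewrite EZ ?invr_ge0//; have := E_D u v; lra. Qed.

(** Stated without infima, so that the property passes to equivalent sequences. The competitors w
    satisfy the constraint at level d, which is chosen before n. *)
Definition quasi_min (s : nat -> V) := forall e, 0 < e -> exists2 d, 0 < d &
  \forall n \near \oo, forall w, E w <= d -> energy (s n) <= energy w + e.

Lemma quasi_min_exists : exists2 s, E (s n) @[n --> \oo] --> 0 & quasi_min s.
Proof.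
pose S (k : nat) := [set energy w | w in [set w | E w <= k.+1%:R^-1]].
have S0 k : S k (energy 0).
  by exists 0 => //=; rewrite -(scale0r 0) EZ// expr0n mul0r.
have lbS k : has_lbound (S k).
  by exists (- (2 * C)) => _ [w _ <-]; exact: energy_ge.
have iS k : has_inf (S k) by split=> //; exists (energy 0).
pose m k := inf (S k).
have m_nd : nondecreasing_seq m.
  move=> k l kl; apply: lb_le_inf; first by exists (energy 0).
  move=> _ [w /= hw <-]; apply: ge_inf => //; exists w => //=.
  apply: le_trans hw _.
  by rewrite lef_pV2 ?posrE// ler_nat.
have m_le k : m k <= energy 0 by apply: ge_inf.
have near_inf k : exists w, E w <= k.+1%:R^-1 /\ energy w < m k + k.+1%:R^-1.
  have k0 : 0 < k.+1%:R^-1 :> R by rewrite invr_gt0.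
  have [_ [w /= hw <-] h] := inf_adherent k0 (iS k).
  by exists w.
have [s hs] := choice near_inf.
exists s.
  apply: (@squeeze_cvgr _ _ _ _ (cst 0) (fun n => n.+1%:R^-1)).
  - by near=> n; rewrite E_ge0 (hs n).1.
  - exact: cvg_cst.
  - exact: cvg_harmonic.
have cm : m n @[n --> \oo] --> sup (range m).
  apply: nondecreasing_cvgn => //.
  by exists (energy 0) => _ [k _ <-].
have ubm : has_sup (range m).
  by split; [exists (m 0%N), 0%N | exists (energy 0) => _ [k _ <-]].
move=> e e0; have e20 : 0 < e / 2 by rewrite divr_gt0.
(* The infima [m k] are bounded by [energy 0], as 0 is always a competitor. Once [m K] is within e /
   2 of their supremum, d = 1 / (K + 1) works: E w <= d gives m K <= energy w, while energy (s n) <=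
   m n + 1 / (n + 1). *)
have [_ [K _ <-] hK] := sup_adherent e20 ubm.
exists K.+1%:R^-1 => //.
have := @cvg_harmonic R => /cvgr0Pnorm_le/(_ _ e20).
apply: filterS => n hn w hw.
have mKw : m K <= energy w by apply: ge_inf => //; exists w.
have mns : m n <= sup (range m) by apply: ub_le_sup; [exact: ubm.2|exists n].
have h1 : energy (s n) <= m n + n.+1%:R^-1 := ltW (hs n).2.
have h2 : n.+1%:R^-1 <= e / 2 := le_trans (ler_norm _) hn.
move: (m n) (m K) (sup _) (n.+1%:R^-1) (energy w) (energy (s n)) h1 h2 mKw mns hK.
move=> *; lra.
Unshelve. all: by end_near. Qed.

Lemma quasi_min_cauchy s : E (s n) @[n --> \oo] --> 0 -> quasi_min s ->
  form_cauchy s.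
Proof.
(* Both energies exceed that of the midpoint by at most e / 16, so [energy_mid] bounds the form by 4
   (e / 16 + e / 16) = e / 2. *)
move=> Es qs e e0; have [|d d0 [N1 _ h1]] := qs (e / 16).
  by rewrite divr_gt0.
have /cvgr0Pnorm_le/(_ _ d0)[N2 _ h2] := Es.
exists (maxn N1 N2) => m n; rewrite !geq_max => /andP[m1 m2] /andP[n1 n2].
have hm := le_trans (ler_norm _) (h2 m m2).
have hn := le_trans (ler_norm _) (h2 n n2).
have hmid : E (2^-1 *: (s m + s n)) <= d by have := E_mid (s m) (s n); lra.
have := h1 _ m1 _ hmid; have := h1 _ n1 _ hmid; rewrite energy_mid; lra.
Qed.

Lemma quasi_min_variational s t : E (s n) @[n --> \oo] --> 0 -> quasi_min s ->
  form_cauchy t -> E (t n) @[n --> \oo] --> 0 ->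
  limn (fun n => f (t n - s n)) <= limn (fun n => a (s n) (t n - s n)).
Proof.
move=> Es qs ct Et; have cs := quasi_min_cauchy Es qs.
have cw := form_cauchyB ct cs.
set A := limn (fun n => a (s n) (t n - s n)).
set F := limn (fun n => f (t n - s n)).
have cA : a (s n) (t n - s n) @[n --> \oo] --> A by exact: form_cvg.
have cF : f (t n - s n) @[n --> \oo] --> F by exact: load_cvg.
have [D D0 hD] := form_cauchy_bounded cw.
have key l : 0 < l -> l < 1 -> F - A <= l * (D + 1).
  (* Here l is the length of the step from s n towards t n. The tolerance is of second order in l,
     so it still tends to 0 after division by l. *)
  move=> l0 l1; have [|d d0 hd] := qs (l ^+ 2 / 2).
    by rewrite divr_gt0 ?exprn_gt0.
  apply: (cvgr_to_le (cvgB cF cA)).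
  have d4 : 0 < d / 4 by rewrite divr_gt0.
  have /cvgr0Pnorm_le/(_ _ d4) := Es; have /cvgr0Pnorm_le/(_ _ d4) := Et.
  apply: filterS3 (filterI hd hD) => n [hn hDn] hEt hEs.
  have /hn : E (s n + l *: (t n - s n)) <= d.
    have -> : s n + l *: (t n - s n) = (1 - l) *: s n + l *: t n.
      by rewrite scalerBr scalerBl scale1r addrA addrAC.
    apply: le_trans (E_D _ _) _; rewrite !EZ ?subr_ge0; try exact: ltW.
    have := le_trans (ler_norm _) hEt; have := le_trans (ler_norm _) hEs.
    have : (1 - l) ^+ 2 * E (s n) <= E (s n) by rewrite ler_piMl//; nra.
    have : l ^+ 2 * E (t n) <= E (t n) by rewrite ler_piMl//; nra.
    lra.
  change (energy (s n) <= energy (s n + l *: (t n - s n)) + l ^+ 2 / 2 ->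
    f (t n - s n) - a (s n) (t n - s n) <= l * (D + 1)).
  move: hDn; move: (t n - s n) => w hDn.
  rewrite /energy !(aD, formDr, aZ, formZr, fD, fZ) (aC w).
  rewrite -subr_ge0 => h; have {}h : l * (f w - a (s n) w) <= l * (l * (D + 1)).
    have := ler_wpM2l (sqr_ge0 l) hDn; have := sqr_ge0 l.
    have := ler_wpM2l (sqr_ge0 l) (ltW D0); rewrite mulr0.
    lra.
  by rewrite ler_pM2l in h.
(* If F - A were positive, l = (F - A) / (F - A + D + 1) would lie in (0, 1) and [key] would give F
   - A <= l (D + 1) < F - A. *)
rewrite leNgt; apply/negP; rewrite -subr_gt0 => FA.
have x0 : 0 < F - A + D + 1 by lra.
have : F - A <= (F - A) / (F - A + D + 1) * (D + 1).
  apply: key; first by rewrite divr_gt0.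
  by rewrite ltr_pdivrMr// mul1r -addrA ltrDl addr_gt0.
rewrite -mulrA -[leLHS]mulr1 ler_pM2l// mulrC ler_pdivlMr// mul1r; lra.
Qed.

(** With p = s' n - s n, the energy changes by a(s n, p) + a(p, p) / 2 - f(p), and each term tends
    to 0. *)
Lemma quasi_min_equiv s s' : form_cauchy s ->
  a (s' n - s n) (s' n - s n) @[n --> \oo] --> 0 -> quasi_min s -> quasi_min s'.
Proof.
move=> cs h qs e e0; have [|d d0 hd] := qs (e / 2); first by rewrite divr_gt0.
exists d => //; have e8 : 0 < e / 8 by rewrite divr_gt0.
have /cvgr0Pnorm_le/(_ _ e8) ha := h.
have /cvgr0Pnorm_le/(_ _ e8) hf := load_null h.
have /cvgr0Pnorm_le/(_ _ e8) haf := form_null cs h.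
apply: filterS (filterI hd (filterI haf (filterI hf ha))).
move=> n [{}hd [{}haf [{}hf {}ha]]] w hw; have := hd w hw.
have -> : s' n = s n + (s' n - s n) by rewrite addrC subrK.
move: (s' n - s n) haf hf ha => p.
have -> : energy (s n + p) = energy (s n) + (a (s n) p + a p p / 2 - f p).
  by rewrite /energy !(aD, formDr, fD) (aC p); field.
rewrite !ler_norml => /andP[? ?] /andP[? ?] /andP[? ?]; lra.
Qed.

(* Testing each inequality with the other solution and adding them gives
   a(s - t, s - t) <= 0 in the limit. *)
Lemma variational_unique s t : form_cauchy s -> form_cauchy t ->
  limn (fun n => f (t n - s n)) <= limn (fun n => a (s n) (t n - s n)) ->
  limn (fun n => f (s n - t n)) <= limn (fun n => a (t n) (s n - t n)) ->
  a (s n - t n) (s n - t n) @[n --> \oo] --> 0.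
Proof.
move=> cs ct hs ht.
have cst := form_cauchyB cs ct; have cts := form_cauchyB ct cs.
have := cvgB (cvgD (load_cvg cts) (load_cvg cst))
  (cvgD (form_cvg cs cts) (form_cvg ct cst)).
set l := (X in _ --> X) => cl.
have {}cl : a (s n - t n) (s n - t n) @[n --> \oo] --> l.
  have <- : (fun n => f (t n - s n) + f (s n - t n) -
      (a (s n) (t n - s n) + a (t n) (s n - t n))) =
      (fun n => a (s n - t n) (s n - t n)).
    by apply/funext => n; rewrite -(opprB (t n)) loadN !formE; ring.
  exact: cl.
suff -> : 0 = l by [].
have h : \forall n \near \oo, 0 <= a (s n - t n) (s n - t n) by exact: nearW.
have l0 := cvgr_to_ge cl h.
by apply/eqP; rewrite eq_le l0 subr_le0 lerD.
Qed.

End form.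

(** * Completeness of L^2 *)

Lemma cvgn_geometric_increments (R : realType) (x : nat -> R) (M : R) :
  (forall k, `|x k.+1 - x k| <= M * 2^-1 ^+ k) -> cvgn x.
Proof.
move=> h.
have -> : x = fun n => x 0%N + series (telescope x) n.
  by apply/funext => n; exact: eq_sum_telescope.
apply: is_cvgD; first exact: is_cvg_cst.
apply: normed_cvg; apply: (series_le_cvg _ _ h) => [k|k|] //=.
  by apply: le_trans (h k); exact: normr_ge0.
apply: is_cvg_geometric_series.
by rewrite ger0_norm ?invr_ge0// invf_lt1// ltr1n.
Qed.

Lemma limn_einf_le (R : realType) (u : (\bar R)^nat) (e : \bar R) :
  (\forall n \near \oo, u n <= e)%E -> (limn_einf u <= e)%E.
Proof.
move=> [N _ hN]; rewrite limn_einf_lim; apply: lime_le.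
  exact: is_cvg_einfs.
exists N => // n Nn; apply: le_trans (hN _ Nn).
by apply: ereal_inf_lbound; exists n => /=.
Qed.

(** Finitely many terms may be infinite; an eventual real bound carries finiteness along. *)
Lemma ge0_cvge0P (R : realType) (u : nat -> \bar R) : (forall n, 0 <= u n)%E ->
  (u n @[n --> \oo] --> 0%E) <->
  (forall e : R, 0 < e -> \forall n \near \oo, (u n <= e%:E)%E).
Proof.
move=> u0; split=> [/fine_cvgP[uf /cvgr0Pnorm_le h] e e0|h].
  apply: filterS2 uf (h e e0) => n uf un.
  by rewrite -(fineK uf) lee_fin; exact: le_trans (ler_norm _) un.
have uf n (e : R) : (u n <= e%:E)%E -> u n \is a fin_num.
  by move=> un; rewrite ge0_fin_numE//; exact: le_lt_trans un (ltry _).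
apply/fine_cvgP; split; first by apply: filterS (h 1 ltr01) => n /uf.
apply/cvgr0Pnorm_le => e e0; apply: filterS (h e e0) => n un.
by rewrite /= ger0_norm ?fine_ge0// -lee_fin fineK// (uf _ _ un).
Qed.

Section L2_complete.
Local Open Scope ereal_scope.
Context d (T : measurableType d) (R : realType) (mu : {measure set T -> \bar R}).
Variables (D : set T) (f : nat -> T -> R).
Hypothesis mD : measurable D.
Hypothesis mf : forall n, measurable_fun D (f n).
Hypothesis cf : forall e : R, (0 < e)%R -> exists N : nat, forall m n : nat,
  (N <= m)%N -> (N <= n)%N -> \int[mu]_(x in D) ((f m x - f n x) ^+ 2)%:E <= e%:E.

(** Riesz-Fischer, with a weighted series of squared increments in place of the series of their
    absolute values: its integral is a sum of nonnegative integrals, so neither Minkowski's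
    inequality nor a finite measure enters. *)
Lemma L2_cauchy_cvg : exists2 g : T -> R, measurable_fun D g &
  \int[mu]_(x in D) ((f n x - g x) ^+ 2)%:E @[n --> \oo] --> 0.
Proof.
have cf8 (k : nat) : exists N : nat, forall m n : nat, (N <= m)%N -> (N <= n)%N ->
    \int[mu]_(x in D) ((f m x - f n x) ^+ 2)%:E <= (8^-1 ^+ k)%:E.
  by apply: cf; rewrite exprn_gt0 ?invr_gt0.
have [N hN] := choice cf8.
(* The sum puts both [phi k] and [phi k.+1] beyond [N k]; the summand k makes [phi] unbounded. *)
pose phi k := (k + \sum_(i < k.+1) N i)%N.
have Nphi k : (N k <= phi k)%N.
  by rewrite /phi big_ord_recr/= addnA leq_addl.
have NphiS k : (N k <= phi k.+1)%N.
  apply: leq_trans (Nphi k) _.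
  by rewrite leq_add// [X in (_ <= X)%N]big_ord_recr/= leq_addr.
have msq (a b : T -> R) : measurable_fun D a -> measurable_fun D b ->
    measurable_fun D (fun x => ((a x - b x) ^+ 2)%:E).
  move=> ma mb; apply/measurable_EFinP; apply: measurable_funX.
  exact: measurable_funB.
pose F k := f (phi k).
have mF k : measurable_fun D (F k) by exact: mf.
(* The increments have squared norm at most 8^-k, so the weight 4^k leaves a summable 2^-k and still
   forces pointwise increments of order 2^-k where the sum is finite. *)
pose w k x := (4 ^+ k * (F k.+1 x - F k x) ^+ 2)%:E.
have w0 k x : 0 <= w k x.
  by rewrite lee_fin mulr_ge0 ?sqr_ge0// exprn_ge0.
have mw k : measurable_fun D (w k).
  apply/measurable_EFinP; apply: measurable_funM; first exact: measurable_cst.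
  by apply: measurable_funX; exact: measurable_funB.
pose S x := \sum_(0 <= k <oo) w k x.
have iS : \int[mu]_(x in D) S x <= 2%:E.
  rewrite /S integral_nneseries//.
  have -> : 2%:E = \sum_(0 <= k <oo) (1 * 2^-1 ^+ k)%:E :> \bar R.
    have := @cvg_geometric_series R 1 2^-1.
    rewrite ger0_norm ?invr_ge0// invf_lt1// ltr1n => /(_ isT) h.
    apply/esym/cvg_lim => //.
    have -> : (fun n => \sum_(0 <= k < n) (1 * 2^-1 ^+ k)%:E) =
        EFin \o series (geometric (1 : R) 2^-1).
      by apply/funext => n; rewrite sumEFin.
    apply: cvg_EFin; first by near=> n.
    by move: h; rewrite (_ : (1 / (1 - 2^-1) = 2 :> R)%R)//; field.
  apply: lee_nneseries => [k _ _|k _]; first exact: integral_ge0.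
  have -> : \int[mu]_(x in D) w k x =
      (4 ^+ k)%:E * \int[mu]_(x in D) ((F k.+1 x - F k x) ^+ 2)%:E.
    rewrite -ge0_integralZl_EFin ?exprn_ge0//.
      by move=> x _; rewrite lee_fin sqr_ge0.
    exact: msq.
  have -> : (1 * 2^-1 ^+ k)%:E = (4 ^+ k)%:E * (8^-1 ^+ k)%:E :> \bar R.
    by rewrite -EFinM -exprMn mul1r; congr (_ ^+ k)%:E; field.
  rewrite lee_pmul2l// ?lte_fin ?exprn_gt0//; exact: hN.
have mS : measurable_fun D S by exact: ge0_emeasurable_sum.
have S0 x : 0 <= S x by exact: nneseries_ge0.
have Sae : \forall x \ae mu, D x -> S x \is a fin_num.
  apply: integrable_ae => //; apply/integrableP; split => //.
  under eq_integral do rewrite gee0_abs//.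
  exact: le_lt_trans iS (ltry _).
(* The upper limit is measurable also across the null set where the subsequence may diverge. *)
pose g x := fine (limn_esup (fun k => (F k x)%:E)).
have mg : measurable_fun D g.
  apply: measurableT_comp => //.
  by apply: measurable_fun_limn_esup => k; exact/measurable_EFinP.
have Fg x : S x \is a fin_num -> F k x @[k --> \oo] --> g x.
  move=> Sx; have cF : cvgn (F ^~ x).
    (* With z = 2^k |D'|, the inequality 2 z <= z^2 + 1 and z^2 <= S x give this constant without a
       square root. *)
    apply: (@cvgn_geometric_increments _ _ ((fine (S x) + 1) / 2)) => k.
    have : w k x <= S x.
      apply: le_trans (nneseries_lim_ge k.+1 _); last by [].
      by rewrite big_nat_recr//= leeDr// sume_ge0.
    rewrite -(fineK Sx) lee_fin; set D' := (_ - _)%R; move: (fine _) => s.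
    have p2 : (0 < 2^-1 ^+ k :> R)%R by rewrite exprn_gt0 ?invr_gt0.
    have -> : (4 ^+ k = (2^-1 ^+ k)^-1 ^+ 2 :> R)%R.
      rewrite -exprVn invrK -exprM mulnC exprM; congr (_ ^+ k)%R; ring.
    move: (2^-1 ^+ k)%R p2 => p p0 h.
    have q0 : (0 <= (p^-1 * `|D'| - 1) ^+ 2)%R by exact: sqr_ge0.
    have nD : (`|D'| ^+ 2 = D' ^+ 2)%R by rewrite real_normK ?num_real.
    have : (2 * (p^-1 * `|D'|) <= s + 1)%R.
      apply: le_trans (_ : (p^-1 ^+ 2 * `|D'| ^+ 2 + 1 <= _)%R); first by nra.
      by rewrite nD lerD2r.
    rewrite mulrCA ler_pdivrMl// => h'.
    by rewrite mulrAC ler_pdivlMr// mulrC [leRHS]mulrC.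
  have h : (F k x)%:E @[k --> \oo] --> (limn (F ^~ x))%:E.
    by apply: cvg_EFin => //; near=> k.
  by rewrite /g (cvg_limn_einf_sup h).2.
exists g => //.
have key (e : R) : (0 < e)%R -> exists K, forall n, (K <= n)%N ->
    \int[mu]_(x in D) ((f n x - g x) ^+ 2)%:E <= e%:E.
  move=> e0; have [K hK] := cf e0; exists K => n Kn.
  pose u k x := ((f n x - F k x) ^+ 2)%:E.
  have mu_ k : measurable_fun D (u k) by exact: msq.
  have u0 k x : 0 <= u k x by rewrite lee_fin sqr_ge0.
  (* Fatou's lemma in k, with n fixed: almost everywhere the lower limit is the squared distance to
     g. *)
  apply: le_trans (_ : \int[mu]_(x in D) limn_einf (u ^~ x) <= _).
    apply: ae_ge0_le_integral => //.
    - by move=> x _; rewrite lee_fin sqr_ge0.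
    - exact: msq.
    - move=> x _; rewrite limn_einf_lim; apply: lime_ge; first exact: is_cvg_einfs.
      by apply: nearW => k; apply: le_ereal_inf_tmp => _ [m _ <-].
    - rewrite (_ : (fun x => limn_einf (u ^~ x)) =
          (fun x => - limn_esup (fun k => - u k x))).
        apply: measurableT_comp => //; apply: measurable_fun_limn_esup => k.
        exact: measurableT_comp.
      apply/funext => x; rewrite -limn_einfN; congr limn_einf.
      by apply/funext => k; exact/esym/oppeK.
    - apply: filterS Sae => x Sx Dx; have {}Sx := Fg x (Sx Dx).
      suff : u k x @[k --> \oo] --> ((f n x - g x) ^+ 2)%:E.
        by move=> /cvg_limn_einf_sup[-> _].
      apply: cvg_EFin; first by near=> k.
      have h := cvgB (cvg_cst (f n x)) Sx.
      change (((f n x - F k x) * (f n x - F k x))%R @[k --> \oo] -->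
        ((f n x - g x) * (f n x - g x))%R).
      by apply: cvgM; exact: h.
  apply: le_trans (fatou mu mD mu_ (fun k x _ => u0 k x)) _.
  apply: limn_einf_le; exists K => // k /= Kk; apply: hK => //.
  by rewrite (leq_trans Kk)// leq_addr.
apply/ge0_cvge0P => [n|e e0].
  by apply: integral_ge0 => x _; rewrite lee_fin sqr_ge0.
by have [K hK] := key e e0; exists K.
Unshelve. all: by end_near. Qed.

End L2_complete.

(** * The form and the load on test functions *)

Section partials.
Context {R : realType}.
Implicit Types (u v : R * R * R -> R) (x : R * R * R).

Lemma partialsD u v : has_partials u -> has_partials v ->
  [/\ d_rho (u + v) = d_rho u + d_rho v,
      d_theta (u + v) = d_theta u + d_theta v & d_y (u + v) = d_y u + d_y v].
Proof.
move=> pu pv; split; apply/funext => x; have [u1 u2 u3] := pu x;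
  have [v1 v2 v3] := pv x.
- change (d_rho (u + v) x = d_rho u x + d_rho v x).
  by have := deriveD u1 v1; rewrite /d_rho 3!derive1E.
- change (d_theta (u + v) x = d_theta u x + d_theta v x).
  by have := deriveD u2 v2; rewrite /d_theta 3!derive1E.
- change (d_y (u + v) x = d_y u x + d_y v x).
  by have := deriveD u3 v3; rewrite /d_y 3!derive1E.
Qed.

Lemma partialsZ t v : has_partials v ->
  [/\ d_rho (fun x => t * v x) = (fun x => t * d_rho v x),
      d_theta (fun x => t * v x) = (fun x => t * d_theta v x) &
      d_y (fun x => t * v x) = (fun x => t * d_y v x)].
Proof.
move=> pv; split; apply/funext => x; have [v1 v2 v3] := pv x.
- by have := deriveZ t v1; rewrite /d_rho 2!derive1E.
- by have := deriveZ t v2; rewrite /d_theta 2!derive1E.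
- by have := deriveZ t v3; rewrite /d_y 2!derive1E.
Qed.

Lemma continuousZ t v : continuous v -> continuous (fun x => t * v x : R).
Proof. by move=> cv x; apply: cvgM; [exact: cvg_cst|exact: cv]. Qed.

Lemma CkZ k t v : Ck k v -> Ck k (fun x => t * v x).
Proof.
elim: k v => [|k IH] v [cv hv]; first by split=> //; exact: continuousZ.
split; first exact: continuousZ.
case: hv => pv [v1 v2 v3]; split.
  move=> x; have [v1' v2' v3'] := pv x; split.
  - exact: (derivableM (derivable_cst t _ _) v1').
  - exact: (derivableM (derivable_cst t _ _) v2').
  - exact: (derivableM (derivable_cst t _ _) v3').
by have [-> -> ->] := partialsZ t pv; split; exact: IH.
Qed.

End partials.

(** * Test functions as a vector space *)

Section Hspace_lmodule.
Context {R : realType} (B : bearing R).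

Lemma admissibleZ (t : R) (v : Hspace B) :
  (fun x => t * v x : R) \in @admissible_pred R B.
Proof.
case: v => v /= /asboolP[sv pv [d d0 dv]]; apply/asboolP; split.
- by move=> k; exact: CkZ.
- by move=> x Dx; rewrite pv.
- by exists d => // x Dx hx; rewrite (dv _ Dx hx) mulr0.
Qed.

Definition Hscale (t : R) (v : Hspace B) : Hspace B := HSpace (admissibleZ t v).

Lemma HscaleA a b v : Hscale a (Hscale b v) = Hscale (a * b) v.
Proof. by apply/val_inj/funext => x; exact: mulrA. Qed.

Lemma Hscale1 : left_id 1 Hscale.
Proof. by move=> v; apply/val_inj/funext => x; exact: mul1r. Qed.

Lemma HscaleDr : right_distributive Hscale +%R.
Proof. by move=> a u v; apply/val_inj/funext => x; exact: mulrDr. Qed.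

Lemma HscaleDl v : {morph Hscale^~ v : a b / a + b}.
Proof. by move=> a b; apply/val_inj/funext => x; exact: mulrDl. Qed.

HB.instance Definition _ := GRing.Zmodule_isLmodule.Build R (Hspace B)
  HscaleA Hscale1 HscaleDr HscaleDl.

Implicit Types u v w : Hspace B.

Lemma H_partials v : has_partials v.
Proof. exact: Cinfty_partials (Hval_Cinfty v). Qed.

Lemma HvalD u v x : (u + v) x = u x + v x. Proof. by []. Qed.
Lemma HvalZ t v x : (t *: v) x = t * v x. Proof. by []. Qed.

Lemma d_rhoD u v x : d_rho (u + v) x = d_rho u x + d_rho v x.
Proof.
have -> : Hval (u + v) = Hval u + Hval v by [].
by have [-> _ _] := partialsD (H_partials u) (H_partials v).
Qed.

Lemma d_thetaD u v x : d_theta (u + v) x = d_theta u x + d_theta v x.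
Proof.
have -> : Hval (u + v) = Hval u + Hval v by [].
by have [_ -> _] := partialsD (H_partials u) (H_partials v).
Qed.

Lemma d_yD u v x : d_y (u + v) x = d_y u x + d_y v x.
Proof.
have -> : Hval (u + v) = Hval u + Hval v by [].
by have [_ _ ->] := partialsD (H_partials u) (H_partials v).
Qed.

Lemma d_rhoZ t v x : d_rho (t *: v) x = t * d_rho v x.
Proof. by have [h _ _] := partialsZ t (H_partials v); rewrite -/(_ x) h. Qed.

Lemma d_thetaZ t v x : d_theta (t *: v) x = t * d_theta v x.
Proof. by have [_ h _] := partialsZ t (H_partials v); rewrite -/(_ x) h. Qed.

Lemma d_yZ t v x : d_y (t *: v) x = t * d_y v x.
Proof. by have [_ _ h] := partialsZ t (H_partials v); rewrite -/(_ x) h. Qed.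

Lemma H_continuous v : [/\ continuous v, continuous (d_rho v),
  continuous (d_theta v) & continuous (d_y v)].
Proof. exact: Cinfty_continuous (Hval_Cinfty v). Qed.

End Hspace_lmodule.

(** * Symmetry, bilinearity and coercivity of the form *)

Section bearing_form.
Context {R : realType} (B : bearing R).
Implicit Types u v w : Hspace B.
Local Notation R1 := (jb_R1 B).
Local Notation R2 := (jb_R2 B).
Local Notation L := (jb_L B).
Local Notation c := (jb_c B).
Local Notation eps := (jb_eps B).
Local Notation form := (@bearing_form R B).

Let R2_gt0 : 0 < R2 := lt_trans (R1_gt0 B) (R1_lt_R2 B).

Definition vol_form (u v : R * R * R -> R) (x : R * R * R) : R :=
  (d_rho u x * d_rho v x + (x.1.1 ^+ 2)^-1 * (d_theta u x * d_theta v x)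
   + d_y u x * d_y v x) * x.1.1.

Definition surf_form (u v : R * R * R -> R) (x : R * R * R) : R :=
  film B x.1.2 ^+ 3 * (k1 B * (d_theta u x * d_theta v x)
    + k2 B * (d_y u x * d_y v x)) * R2.

Lemma bearing_formE u v : form u v =
  \int[volume R]_(x in Q B) vol_form u v x +
  \int[area R]_(z in C2 B) surf_form u v (R2, z.1, z.2).
Proof. by []. Qed.

Lemma continuous_mul (F G : R * R * R -> R) : continuous F -> continuous G ->
  continuous (fun x => F x * G x : R).
Proof. by move=> cF cG x; apply: cvgM; [exact: cF|exact: cG]. Qed.

Lemma continuous_add (F G : R * R * R -> R) : continuous F -> continuous G ->
  continuous (fun x => F x + G x : R).
Proof. by move=> cF cG x; apply: cvgD; [exact: cF|exact: cG]. Qed.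

Lemma continuous_expn (F : R * R * R -> R) n : continuous F ->
  continuous (fun x => F x ^+ n : R).
Proof.
move=> cF; elim: n => [|n IH]; first by move=> x; exact: cvg_cst.
have -> : (fun x => F x ^+ n.+1) = (fun x => F x * F x ^+ n).
  by apply/funext => x; rewrite exprS.
exact: continuous_mul.
Qed.

Lemma continuous_comp_theta (F : R -> R) : continuous F ->
  continuous (fun x : R * R * R => F x.1.2).
Proof.
move=> cF x; apply: (@continuous_comp _ _ _ (fun x : R * R * R => x.1.2) F).
  by apply: (@continuous_comp _ _ _ fst snd); [exact: cvg_fst|exact: cvg_snd].
exact: cF.
Qed.

Lemma continuous_film : continuous (film B).
Proof.
move=> x; apply: cvgM; first exact: cvg_cst.
apply: cvgD; first exact: cvg_cst.
by apply: cvgM; [exact: cvg_cst|exact: continuous_cos].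
Qed.

Lemma integrable_surf_form u v :
  (area R).-integrable (C2 B) (EFin \o (fun z => surf_form u v (R2, z.1, z.2))).
Proof.
have [_ _ u2 u3] := H_continuous u; have [_ _ v2 v3] := H_continuous v.
have cc (k : R) : continuous (fun _ : R * R * R => k) by move=> x; exact: cvg_cst.
apply: integrable_C2; apply: continuous_mul => //; apply: continuous_mul.
  by apply: continuous_expn; apply: continuous_comp_theta; exact: continuous_film.
by apply: continuous_add; apply: continuous_mul => //; exact: continuous_mul.
Qed.

Lemma integrable_vol_form u v :
  (volume R).-integrable (Q B) (EFin \o vol_form u v).
Proof.
have [_ u1 u2 u3] := H_continuous u; have [_ v1 v2 v3] := H_continuous v.
(* Truncating rho below at R1 > 0 makes the weight rho^-2 continuous on the whole space and changes
   nothing on Q. *)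
pose r (x : R * R * R) := Num.max x.1.1 R1.
have r0 x : 0 < r x by rewrite lt_max R1_gt0 orbT.
have cr : continuous r.
  move=> x; apply: (@continuous_max R _ (fun x => x.1.1) (fun=> R1)).
    by apply: (@continuous_comp _ _ _ fst fst); exact: cvg_fst.
  exact: cvg_cst.
pose G x := (d_rho u x * d_rho v x + (r x ^+ 2)^-1 * (d_theta u x * d_theta v x)
   + d_y u x * d_y v x) * r x.
apply: (@eq_integrable _ _ _ _ _ (@measurable_Q R B) (EFin \o G)).
  move=> x /set_mem[[/= x1 _] _]; rewrite /G /vol_form /= /r.
  suff -> : Num.max x.1.1 R1 = x.1.1 by [].
  by apply/max_idPl; move: x1; rewrite /= in_itv /= => /andP[/ltW].
apply: integrable_Q; apply: continuous_mul => //.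
apply: continuous_add; last exact: continuous_mul.
apply: continuous_add; first exact: continuous_mul.
apply: continuous_mul; last exact: continuous_mul.
move=> x; apply: cvgV; first by rewrite expf_neq0// gt_eqF.
exact: continuous_expn.
Qed.

Let vol_symE (a a' b b' e e' q r : R) :
  (a * a' + q * (b * b') + e * e') * r = (a' * a + q * (b' * b) + e' * e) * r.
Proof. ring. Qed.

Let surf_symE (b b' e e' h p q r : R) :
  h * (p * (b * b') + q * (e * e')) * r = h * (p * (b' * b) + q * (e' * e)) * r.
Proof. ring. Qed.

Lemma bearing_formC u v : form u v = form v u.
Proof.
rewrite !bearing_formE; apply: f_equal2; apply: eq_Rintegral => x _.
  exact: vol_symE.
exact: surf_symE.
Qed.

Let vol_addE (a a' a'' b b' b'' e e' e'' q r : R) :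
  ((a + a') * a'' + q * ((b + b') * b'') + (e + e') * e'') * r =
  (a * a'' + q * (b * b'') + e * e'') * r +
  (a' * a'' + q * (b' * b'') + e' * e'') * r.
Proof. ring. Qed.

Let surf_addE (b b' b'' e e' e'' h p q r : R) :
  h * (p * ((b + b') * b'') + q * ((e + e') * e'')) * r =
  h * (p * (b * b'') + q * (e * e'')) * r +
  h * (p * (b' * b'') + q * (e' * e'')) * r.
Proof. ring. Qed.

Let vol_scaleE (t a a' b b' e e' q r : R) :
  (t * a * a' + q * (t * b * b') + t * e * e') * r =
  t * ((a * a' + q * (b * b') + e * e') * r).
Proof. ring. Qed.

Let surf_scaleE (t b b' e e' h p q r : R) :
  h * (p * (t * b * b') + q * (t * e * e')) * r =
  t * (h * (p * (b * b') + q * (e * e')) * r).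
Proof. ring. Qed.

Let mQ := @measurable_Q R B.
Let mC2 := @measurable_C2 R B.

Lemma bearing_formD u v w : form (u + v) w = form u w + form v w.
Proof.
rewrite !bearing_formE addrACA; apply: f_equal2.
  apply: etrans; last first.
    exact: (RintegralD mQ (integrable_vol_form u w) (integrable_vol_form v w)).
  apply: eq_Rintegral => x _.
  by rewrite /vol_form d_rhoD d_thetaD d_yD; exact: vol_addE.
apply: etrans; last first.
  exact: (RintegralD mC2 (integrable_surf_form u w) (integrable_surf_form v w)).
apply: eq_Rintegral => z _.
by rewrite /surf_form d_thetaD d_yD; exact: surf_addE.
Qed.

Lemma bearing_formZ t u w : form (t *: u) w = t * form u w.
Proof.
rewrite !bearing_formE mulrDr; apply: f_equal2.
  apply: etrans; last exact: (RintegralZl t mQ (integrable_vol_form u w)).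
  apply: eq_Rintegral => x _.
  by rewrite /vol_form d_rhoZ d_thetaZ d_yZ; exact: vol_scaleE.
apply: etrans; last exact: (RintegralZl t mC2 (integrable_surf_form u w)).
apply: eq_Rintegral => z _.
by rewrite /surf_form d_thetaZ d_yZ; exact: surf_scaleE.
Qed.

Lemma film_ge t : c * (1 - eps) <= film B t.
Proof.
rewrite ler_pM2l ?c_gt0// lerD2l.
by have := ler_wpM2l (ltW (eps_gt0 B)) (cos_geN1 t); rewrite mulrN1.
Qed.

Lemma film_le t : film B t <= c * 2.
Proof.
rewrite ler_pM2l ?c_gt0//.
have := ler_wpM2l (ltW (eps_gt0 B)) (cos_le1 t); rewrite mulr1.
by have := eps_lt1 B; lra.
Qed.

Local Notation hmin := ((c * (1 - eps)) ^+ 3).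
Local Notation hmax := ((c * 2) ^+ 3).

Let hmin_gt0 : 0 < hmin.
Proof. by rewrite exprn_gt0 ?mulr_gt0 ?c_gt0 ?subr_gt0 ?eps_lt1. Qed.

Lemma film3_bounds t : hmin <= film B t ^+ 3 <= hmax.
Proof.
have h0 : 0 <= c * (1 - eps) by rewrite mulr_ge0 ?(ltW (c_gt0 B))// subr_ge0 ltW ?eps_lt1.
have f0 := le_trans h0 (film_ge t).
have h2 : 0 <= c * 2 := le_trans f0 (film_le t).
apply/andP; split; apply: lerXn2r.
- exact: h0.
- exact: f0.
- exact: film_ge.
- exact: f0.
- exact: h2.
- exact: film_le.
Qed.

Lemma surf_density_ge0 (v : R * R * R -> R) x : 0 <= surf_density B v x.
Proof.
by rewrite mulr_ge0 ?(ltW R2_gt0)// addr_ge0// mulr_ge0 ?sqr_ge0//;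
  [exact/ltW/k1_gt0 | exact/ltW/k2_gt0].
Qed.

Lemma surf_form_diag v x :
  surf_form v v x = film B x.1.2 ^+ 3 * surf_density B v x.
Proof. by rewrite /surf_form /surf_density !expr2; exact/esym/mulrA. Qed.

Lemma vol_form_diag v x : vol_form v v x = vol_density v x.
Proof. by rewrite /vol_form /vol_density !expr2. Qed.

Local Notation vol_energy v := (\int[volume R]_(x in Q B) vol_density v x).
Local Notation surf_energy v :=
  (\int[area R]_(z in C2 B) surf_density B v (R2, z.1, z.2)).

Let integrable_surf_energy v : (area R).-integrable (C2 B)
  (EFin \o (fun z => surf_density B v (R2, z.1, z.2))).
Proof. exact: integrable_surf_density (Hval_Cinfty v). Qed.

Let vol_energy_ge0 v : 0 <= vol_energy v.
Proof.
apply: Rintegral_ge0 => x [[/= x1 _] _]; rewrite /vol_density.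
have x0 : 0 <= x.1.1.
  by move: x1; rewrite /= in_itv/= => /andP[/ltW x1 _]; exact: le_trans (ltW (R1_gt0 B)) x1.
by rewrite mulr_ge0// !addr_ge0 ?sqr_ge0// mulr_ge0 ?sqr_ge0// invr_ge0 sqr_ge0.
Qed.

Let surf_energy_ge0 v : 0 <= surf_energy v.
Proof. by apply: Rintegral_ge0 => z _; exact: surf_density_ge0. Qed.

(** Since eps < 1, the cube of the film thickness lies between two positive constants. This makes
    the form equivalent to the square of [Hnorm]. *)
Lemma bearing_form_diag_bounds v :
  vol_energy v + hmin * surf_energy v <= form v v <=
  vol_energy v + hmax * surf_energy v.
Proof.
have eV : \int[volume R]_(x in Q B) vol_form v v x = vol_energy v.
  by apply: eq_Rintegral => x _; exact: vol_form_diag.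
have iZ k : (area R).-integrable (C2 B)
    (EFin \o (fun z => k * surf_density B v (R2, z.1, z.2))).
  have := integrableZl mC2 k (integrable_surf_energy v).
  by apply: eq_integrable.
have eS k : \int[area R]_(z in C2 B) (k * surf_density B v (R2, z.1, z.2)) =
    k * surf_energy v := RintegralZl k mC2 (integrable_surf_energy v).
rewrite bearing_formE eV !lerD2l; apply/andP; split; rewrite -eS.
- apply: (le_Rintegral mC2 (iZ _) (integrable_surf_form v v)) => z _.
  rewrite surf_form_diag ler_wpM2r ?surf_density_ge0//.
  by have /andP[] := film3_bounds z.1.
- apply: (le_Rintegral mC2 (integrable_surf_form v v) (iZ _)) => z _.
  rewrite surf_form_diag ler_wpM2r ?surf_density_ge0//.
  by have /andP[] := film3_bounds z.1.
Qed.

Lemma Hnorm_sqr v : Hnorm B v ^+ 2 = vol_energy v + surf_energy v.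
Proof.
rewrite Hnorm_density; apply: sqr_sqrtr.
exact: (addr_ge0 (vol_energy_ge0 v) (surf_energy_ge0 v)).
Qed.

Lemma bearing_form_ge0 v : 0 <= form v v.
Proof.
have /andP[h _] := bearing_form_diag_bounds v; apply: le_trans h.
by rewrite addr_ge0 ?vol_energy_ge0// mulr_ge0 ?surf_energy_ge0// ltW ?hmin_gt0.
Qed.

Lemma bearing_form_coercive :
  exists2 m, 0 < m & forall v, m * Hnorm B v ^+ 2 <= form v v.
Proof.
exists (Num.min 1 hmin); first by rewrite lt_min ltr01 hmin_gt0.
move=> v; have /andP[h _] := bearing_form_diag_bounds v; apply: le_trans h.
rewrite Hnorm_sqr mulrDr; apply: lerD.
  by rewrite ler_piMl ?vol_energy_ge0// ge_min lexx.
by rewrite ler_wpM2r ?surf_energy_ge0// ge_min lexx orbT.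
Qed.

Lemma bearing_form_bounded :
  exists2 M, 0 < M & forall v, form v v <= M * Hnorm B v ^+ 2.
Proof.
exists (Num.max 1 hmax); first by rewrite lt_max ltr01.
move=> v; have /andP[_ h] := bearing_form_diag_bounds v; apply: le_trans h _.
rewrite Hnorm_sqr [leRHS]mulrDr; apply: lerD.
  by rewrite ler_peMl ?vol_energy_ge0// le_max lexx.
by rewrite ler_wpM2r ?surf_energy_ge0// le_max lexx orbT.
Qed.

End bearing_form.

(** * Poincare inequality, negative parts and the load *)

Section trace_estimates.
Context {R : realType} (B : bearing R).
Implicit Types u v w : Hspace B.
Local Notation R1 := (jb_R1 B).
Local Notation R2 := (jb_R2 B).
Local Notation L := (jb_L B).
Local Notation c := (jb_c B).
Local Notation eps := (jb_eps B).
Local Notation form := (@bearing_form R B).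

Let R2_gt0 : 0 < R2 := lt_trans (R1_gt0 B) (R1_lt_R2 B).

Lemma continuous_cst3 (k : R) : continuous (fun _ : R * R * R => k).
Proof. by move=> x; exact: cvg_cst. Qed.

Lemma continuous_y : continuous (fun x : R * R * R => x.2).
Proof. by move=> x; exact: cvg_snd. Qed.

Lemma H_at_ends v theta : v (R2, theta, 0) = 0 /\ v (R2, theta, L) = 0.
Proof.
case: v => v /= /asboolP[_ _ [d d0 dv]].
have R2in : R1 <= R2 <= R2 by rewrite lexx (ltW (R1_lt_R2 B)).
split; apply: dv.
- split; first by split=> //=; rewrite in_itv.
  by rewrite /= in_itv/= lexx (ltW (L_gt0 B)).
- by right; left.
- split; first by split=> //=; rewrite in_itv.
  by rewrite /= in_itv/= lexx (ltW (L_gt0 B)).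
- by right; right; rewrite /= ltrBlDr ltrDl.
Qed.

(* This is the y-derivative of y v^2, hence its integral over (0, L) is 0. *)
Definition multiplier (v : R * R * R -> R) x : R :=
  v x ^+ 2 + 2 * x.2 * v x * d_y v x.

Lemma continuous_multiplier v : continuous (multiplier v).
Proof.
have [cv _ _ cvy] := H_continuous v.
apply: continuous_add; first exact: continuous_expn.
apply: continuous_mul => //; apply: continuous_mul => //.
by apply: continuous_mul; [exact: continuous_cst3|exact: continuous_y].
Qed.

Lemma continuous_line (F : R * R * R -> R) theta : continuous F ->
  continuous (fun y : R => F (R2, theta, y)).
Proof.
move=> cF y; apply: (@continuous_comp _ _ _ (fun y : R => (R2, theta, y)) F).
  exact: (@cvg_pair _ _ _ (nbhs y) (nbhs (R2, theta)) (nbhs y) _ _ _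
    (fun=> (R2, theta)) id (cvg_cst _) cvg_id).
exact: cF.
Qed.

Lemma integral_multiplier_line v theta :
  (\int[@lebesgue_measure R]_(y in `]0%R, L[) (multiplier v (R2, theta, y))%:E = 0)%E.
Proof.
have cm := continuous_line (theta := theta) (@continuous_multiplier v).
have mm (D : set R) : measurable_fun D (fun y => (multiplier v (R2, theta, y))%:E).
  by apply/measurable_EFinP; apply: measurable_funTS; exact: continuous_measurable_fun.
rewrite integral_itv_bndo_bndc// integral_itv_obnd_cbnd//.
pose phi (y : R) : R := v (R2, theta, y).
pose F (y : R) : R := y * (phi y * phi y).
have dF (y : R) : is_derive y (1 : R) F (multiplier v (R2, theta, y)).
  have [_ _ h] := H_partials v (R2, theta, y).
  have {}h : is_derive y (1 : R) phi (d_y v (R2, theta, y)).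
    by rewrite /d_y derive1E; exact: derivableP h.
  set d := d_y v _ in h *.
  have h2 : is_derive y (1 : R) F
      (y *: (phi y *: d + phi y *: d) + (phi y * phi y) *: (1 : R)).
    exact: (is_deriveM (is_derive_id y (1 : R)) (is_deriveM h h)).
  apply: (is_derive_eq h2).
  change (y * (phi y * d_y v (R2, theta, y) + phi y * d_y v (R2, theta, y)) +
    phi y * phi y * 1 = phi y ^+ 2 + 2 * y * phi y * d_y v (R2, theta, y)).
  by move: (phi y) (d_y v _) => a b; ring.
rewrite (@continuous_FTC2 _ _ F) ?L_gt0//.
(* At L the test function vanishes, at 0 the factor y does. *)
- by rewrite /F /phi (H_at_ends v theta).2 !mulr0 mul0r subee.
- exact: continuous_subspaceT.
- have cF (y : R) : F y' @[y' --> y] --> F y.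
    have [cv _ _ _] := H_continuous v; have cphi := continuous_line cv (theta := theta).
    by apply: cvgM; [exact: cvg_id|apply: cvgM; exact: cphi].
  split.
  + by move=> y _; have [] := dF y.
  + exact/cvg_at_right_filter.
  + exact/cvg_at_left_filter.
- by move=> y _; rewrite derive1E; have [] := dF y.
Qed.

Lemma integral_multiplier v :
  \int[area R]_(z in C2 B) multiplier v (R2, z.1, z.2) = 0.
Proof.
rewrite /Rintegral integral_mkcond -fubini1; last first.
  apply: (iffLR (integrable_mkcond _ (@measurable_C2 R B))).
  exact: integrable_C2 (@continuous_multiplier v).
rewrite integral0_eq// => theta _; rewrite /fubini_F.
have [h|h] := boolP (theta \in `]0%R, 2 * pi]).
  rewrite -(integral_multiplier_line v theta) [RHS]integral_mkcond.
  apply: eq_integral => y _; rewrite /patch.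
  have -> // : ((theta, y) \in C2 B) = (y \in `]0%R, L[%classic).
  apply/idP/idP => /set_mem hy; apply/mem_set; first by case: hy.
  by split.
rewrite integral0_eq// => y _; rewrite /patch ifF//.
by apply/negP => /set_mem[/= h' _]; move/negP: h.
Qed.

Lemma surf_form_le v :
  \int[area R]_(z in C2 B) surf_form B v v (R2, z.1, z.2) <= form v v.
Proof.
rewrite bearing_formE lerDr; apply: Rintegral_ge0 => x [[/= x1 _] _].
have x0 : 0 <= x.1.1.
  by move: x1; rewrite /= in_itv/= => /andP[/ltW x1 _]; exact: le_trans (ltW (R1_gt0 B)) x1.
rewrite vol_form_diag /vol_density.
by rewrite mulr_ge0// !addr_ge0 ?sqr_ge0// mulr_ge0 ?sqr_ge0// invr_ge0 sqr_ge0.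
Qed.

Lemma integrable_trace_sqr v :
  (area R).-integrable (C2 B) (EFin \o (fun z => v (R2, z.1, z.2) ^+ 2)).
Proof.
have [cv _ _ _] := H_continuous v.
exact: integrable_C2 (continuous_expn (n := 2) cv).
Qed.

(** Expand (a + 2 y b)^2 >= 0 and enlarge y^2 to l^2. For a = v and b = v_y the first bracket is the
    multiplier, which integrates to 0; what remains is Poincare's inequality with constant 4 L^2. *)
Let mult_young (a b y l : R) : 0 < y < l ->
  a ^+ 2 <= 2 * (a ^+ 2 + 2 * y * a * b) + 2 * (2 * l ^+ 2 * b ^+ 2).
Proof.
move=> /andP[y0 yl]; have := sqr_ge0 (a + 2 * y * b).
have : y ^+ 2 * b ^+ 2 <= l ^+ 2 * b ^+ 2.
  rewrite ler_wpM2r ?sqr_ge0//; apply: lerXn2r; rewrite ?nnegrE//; lra.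
lra.
Qed.

Let surf_ge (h0 h1 p q r a b : R) : 0 <= h0 -> h0 <= h1 -> 0 <= p -> 0 <= q ->
  0 <= r -> 0 <= a -> 0 <= b -> h0 * q * r * b <= h1 * ((p * a + q * b) * r).
Proof.
move=> h00 h01 p0 q0 r0 a0 b0; rewrite -!mulrA; apply: ler_pM => //.
  by rewrite !mulr_ge0.
by rewrite mulrDl -!mulrA (mulrC r b) lerDr !mulr_ge0.
Qed.

Lemma trace_sqr_le : exists2 K, 0 < K & forall v,
  \int[area R]_(z in C2 B) v (R2, z.1, z.2) ^+ 2 <= K * form v v.
Proof.
(* A lower bound for the coefficient of v_y^2 in the surface term of the form. *)
pose m := (c * (1 - eps)) ^+ 3 * k2 B * R2.
have m0 : 0 < m.
  apply: mulr_gt0 R2_gt0; apply: mulr_gt0 (k2_gt0 B); apply: exprn_gt0.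
  by rewrite mulr_gt0 ?c_gt0// subr_gt0 eps_lt1.
pose K := 2 * L ^+ 2 / m.
have K0 : 0 < K by rewrite divr_gt0// mulr_gt0// exprn_gt0// L_gt0.
exists (2 * K) => [|v]; first by rewrite mulr_gt0.
have mC := @measurable_C2 R B.
have iS := integrable_surf_form v v.
have iK : (area R).-integrable (C2 B)
    (EFin \o (fun z => K * surf_form B v v (R2, z.1, z.2))).
  have := integrableZl mC K iS.
  by apply: eq_integrable.
have iM : (area R).-integrable (C2 B)
    (EFin \o (fun z => multiplier v (R2, z.1, z.2))).
  exact: integrable_C2 (@continuous_multiplier v).
have := jb_le_int2 mC (integrable_trace_sqr v) iM iK.
move=> h; apply: le_trans (h _) _ => {h} [z [_ /= hy]|].
  move: hy; rewrite /= in_itv/= => /mult_young h.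
  apply: le_trans (h (v (R2, z.1, z.2)) (d_y v (R2, z.1, z.2))) _.
  rewrite /multiplier lerD2l ler_pM2l// /K -[leRHS]mulrA ler_pM2l; last first.
    by apply: mulr_gt0 => //; apply: exprn_gt0; exact: L_gt0.
  rewrite ler_pdivlMl// surf_form_diag.
  have /andP[f1 _] := film3_bounds B z.1.
  apply: surf_ge _ f1 (ltW (k1_gt0 B)) (ltW (k2_gt0 B)) (ltW R2_gt0) _ _.
  - apply: exprn_ge0; rewrite mulr_ge0 ?(ltW (c_gt0 B))// subr_ge0 ltW//.
    exact: eps_lt1.
  - exact: sqr_ge0.
  - exact: sqr_ge0.
rewrite integral_multiplier mulr0 add0r (RintegralZl K mC iS) mulrA.
by apply: ler_wpM2l (surf_form_le v); rewrite ltW// mulr_gt0.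
Qed.

Definition neg_trace (v : Hspace B) (z : R * R) : R :=
  Num.min (v (R2, z.1, z.2)) 0.

Definition neg_energy v : R := \int[area R]_(z in C2 B) neg_trace v z ^+ 2.

Lemma integrable_neg_trace_sqr v :
  (area R).-integrable (C2 B) (EFin \o (fun z => neg_trace v z ^+ 2)).
Proof.
have [cv _ _ _] := H_continuous v.
have cm : continuous (fun x => Num.min (v x) 0 : R).
  move=> x; apply: (@continuous_min R _ v (fun=> 0)); first exact: cv.
  exact: cvg_cst.
exact: integrable_C2 (continuous_expn (n := 2) cm).
Qed.

Lemma neg_energy_ge0 v : 0 <= neg_energy v.
Proof. by apply: Rintegral_ge0 => z _; exact: sqr_ge0. Qed.

(** The map min(., 0) is superadditive and nonpositive, so min(a + b, 0) lies between p + q and 0,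
    where p and q are the two minima. *)
Let min0_sqrD (a b : R) :
  Num.min (a + b) 0 ^+ 2 <= 2 * Num.min a 0 ^+ 2 + 2 * Num.min b 0 ^+ 2.
Proof.
have pq : Num.min a 0 + Num.min b 0 <= Num.min (a + b) 0.
  by rewrite le_min lerD ?ge_min ?lexx// -[leRHS]addr0 lerD ?ge_min ?lexx ?orbT.
have x0 : Num.min (a + b) 0 <= 0 by rewrite ge_min lexx orbT.
move: (Num.min (a + b) 0) (Num.min a 0) (Num.min b 0) pq x0 => x p q pq x0.
(* The product of these two nonpositive factors is (p + q)^2 - x^2. *)
have := sqr_ge0 (p - q); have := mulr_le0 (_ : p + q - x <= 0) (_ : p + q + x <= 0).
have -> : p + q - x <= 0 by lra.
have -> : p + q + x <= 0 by lra.
by move=> /(_ isT isT); lra.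
Qed.

Lemma neg_energyD u v :
  neg_energy (u + v) <= 2 * neg_energy u + 2 * neg_energy v.
Proof.
apply: (jb_le_int2 (@measurable_C2 R B) (integrable_neg_trace_sqr (u + v))
  (integrable_neg_trace_sqr u) (integrable_neg_trace_sqr v)) => z _.
exact: min0_sqrD.
Qed.

Lemma neg_energyZ t v : 0 <= t -> neg_energy (t *: v) = t ^+ 2 * neg_energy v.
Proof.
move=> t0; apply: etrans; last first.
  exact: (RintegralZl (t ^+ 2) (@measurable_C2 R B) (integrable_neg_trace_sqr v)).
apply: eq_Rintegral => z _; rewrite -exprMn; congr (_ ^+ 2).
by rewrite /neg_trace HvalZ minr_pMr// mulr0.
Qed.

Lemma neg_energy_le v :
  neg_energy v <= \int[area R]_(z in C2 B) v (R2, z.1, z.2) ^+ 2.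
Proof.
apply: (le_Rintegral (@measurable_C2 R B) (integrable_neg_trace_sqr v)
  (integrable_trace_sqr v)) => z _; rewrite /neg_trace.
by have [h|h] := ltP (v (R2, z.1, z.2)) 0; rewrite ?lexx// expr0n sqr_ge0.
Qed.

Lemma derive1_film t : derive1 (film B) t = - (c * eps * sin t).
Proof.
have h : is_derive t (1 : R) (film B) (c *: (0 + eps *: - sin t)).
  exact: (is_deriveZ c (is_deriveD (is_derive_cst (1 : R) t (1 : R))
    (is_deriveZ eps (is_derive_cos t)))).
rewrite derive1E; have [_ ->] := h.
change (c * (0 + eps * - sin t) = - (c * eps * sin t)); ring.
Qed.

Lemma continuous_derive1_film : continuous (derive1 (film B)).
Proof.
have -> : derive1 (film B) = (fun t => - (c * eps) * sin t).
  by apply/funext => t; rewrite derive1_film mulNr.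
by move=> t; apply: cvgM; [exact: cvg_cst|exact: continuous_sin].
Qed.

Definition load_density (v : R * R * R -> R) (x : R * R * R) : R :=
  k3 B * derive1 (film B) x.1.2 * v x * R2.

Lemma integrable_load v : (area R).-integrable (C2 B)
  (EFin \o (fun z => load_density v (R2, z.1, z.2))).
Proof.
have [cv _ _ _] := H_continuous v.
apply: integrable_C2; apply: continuous_mul; last exact: continuous_cst3.
apply: continuous_mul => //; apply: continuous_mul; first exact: continuous_cst3.
by apply: continuous_comp_theta; exact: continuous_derive1_film.
Qed.

Lemma bearing_loadD u v :
  bearing_load B (u + v) = bearing_load B u + bearing_load B v.
Proof.
apply: etrans; last first.
  exact: (RintegralD (@measurable_C2 R B) (integrable_load u) (integrable_load v)).
apply: eq_Rintegral => z _; rewrite HvalD mulrDr mulrDl.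
reflexivity.
Qed.

Lemma bearing_loadZ t v : bearing_load B (t *: v) = t * bearing_load B v.
Proof.
apply: etrans; last first.
  exact: (RintegralZl t (@measurable_C2 R B) (integrable_load v)).
by apply: eq_Rintegral => z _; rewrite HvalZ mulrCA -mulrA.
Qed.

Let load_young (a b e s w v K : R) : 0 < K -> s ^+ 2 <= 1 ->
  a * - (e * s) * v * w <= K * (a * e * w) ^+ 2 + K^-1 * v ^+ 2.
Proof.
move=> K0 s1; have [D [DK ->]] : exists D, D * K = 1 /\ K^-1 = D.
  by exists K^-1; rewrite mulVf ?gt_eqF.
have D0 : 0 <= D by rewrite -(pmulr_lge0 _ K0) DK.
have h1 : 0 <= D * (v + K * (a * e * w) * s) ^+ 2 by rewrite mulr_ge0 ?sqr_ge0.
have h2 : 0 <= K * (a * e * w) ^+ 2 * (1 - s ^+ 2).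
  by rewrite mulr_ge0 ?subr_ge0// mulr_ge0 ?sqr_ge0// ltW.
have h3 : 0 <= D * v ^+ 2 by rewrite mulr_ge0 ?sqr_ge0.
have h4 : 0 <= K * (a * e * w) ^+ 2 * s ^+ 2.
  exact: mulr_ge0 (mulr_ge0 (ltW K0) (sqr_ge0 _)) (sqr_ge0 _).
have : D * (v + K * (a * e * w) * s) ^+ 2 = D * v ^+ 2 +
   2 * (D * K) * (a * e * w) * s * v + (D * K) * (K * (a * e * w) ^+ 2 * s ^+ 2).
  ring.
rewrite DK; lra.
Qed.

(** Young's inequality with the constant K of [trace_sqr_le] as weight: the integral of v^2 / K is
    then at most the form, with coefficient exactly 1. *)
Lemma bearing_load_le : exists C, forall v, bearing_load B v <= C + form v v.
Proof.
have [K K0 hK] := trace_sqr_le.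
pose G := k3 B * (c * eps) * R2.
have mC := @measurable_C2 R B.
have iG : (area R).-integrable (C2 B) (EFin \o (fun=> K * G ^+ 2)).
  by apply: (@integrable_C2 R B (fun=> K * G ^+ 2)); exact: continuous_cst3.
have iT v : (area R).-integrable (C2 B)
    (EFin \o (fun z => K^-1 * v (R2, z.1, z.2) ^+ 2)).
  have := integrableZl mC K^-1 (integrable_trace_sqr v).
  by apply: eq_integrable.
have i2 v := integrableD mC iG (iT v).
exists (\int[area R]_(z in C2 B) (K * G ^+ 2)) => v.
apply: le_trans (_ : \int[area R]_(z in C2 B)
    (K * G ^+ 2 + K^-1 * v (R2, z.1, z.2) ^+ 2) <= _).
  apply: (le_Rintegral mC (integrable_load v)).
    by move: (i2 v); apply: eq_integrable => // z _; rewrite /= EFinD.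
  move=> z _; rewrite /load_density derive1_film /G; apply: load_young => //=.
rewrite (RintegralD mC iG (iT v)) lerD2l (RintegralZl _ mC (integrable_trace_sqr v)).
by rewrite ler_pdivrMl.
Qed.

End trace_estimates.

(** * The completion *)

Lemma ge0_le_integral2 d (T : measurableType d) (R : realType)
    (mu : {measure set T -> \bar R}) (D : set T) (f g h : T -> R) :
  measurable D -> measurable_fun D f -> measurable_fun D g ->
  measurable_fun D h -> (forall x, 0 <= f x) -> (forall x, 0 <= g x) ->
  (forall x, 0 <= h x) -> (forall x, D x -> f x <= 2 * g x + 2 * h x) ->
  (\int[mu]_(x in D) (f x)%:E <= 2%:E * \int[mu]_(x in D) (g x)%:E +
    2%:E * \int[mu]_(x in D) (h x)%:E)%E.
Proof.
move=> mD mf mg mh f0 g0 h0 fgh.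
have m2 (k : T -> R) : measurable_fun D k ->
    measurable_fun D (fun x => 2%:E * (k x)%:E)%E.
  move=> mk; apply: (eq_measurable_fun (EFin \o (fun x => 2 * k x))).
    by move=> x _; rewrite /= EFinM.
  by apply/measurable_EFinP; apply: measurable_funM.
have n2 (k : T -> R) : (forall x, 0 <= k x) ->
    (forall x, D x -> 0 <= 2%:E * (k x)%:E)%E.
  by move=> k0 x _; rewrite -EFinM lee_fin mulr_ge0.
rewrite -!ge0_integralZl_EFin//; try (by move=> x _; rewrite lee_fin);
  try exact/measurable_EFinP.
rewrite -ge0_integralD//; try exact: n2; try exact: m2.
apply: ge0_le_integral; first exact: mD.
- by move=> x _; rewrite lee_fin.
- exact/measurable_EFinP.
- by apply: emeasurable_funD; exact: m2.
- by move=> x Dx; rewrite -!EFinM -EFinD lee_fin fgh.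
Qed.

Section Hform.
Context {R : realType} (B : bearing R).
Implicit Types u v w : Hspace B.

(** Restricted to the module of test functions, the form and the load get the types expected by the
    abstract minimization. *)
Definition Hform u v : R := bearing_form B u v.
Definition Hload v : R := bearing_load B v.

Lemma HformC u v : Hform u v = Hform v u.
Proof. exact: bearing_formC. Qed.

Lemma HformD u v w : Hform (u + v) w = Hform u w + Hform v w.
Proof. exact: bearing_formD. Qed.

Lemma HformZ t u w : Hform (t *: u) w = t * Hform u w.
Proof. exact: bearing_formZ. Qed.

Lemma Hform_ge0 v : 0 <= Hform v v.
Proof. exact: bearing_form_ge0. Qed.

Lemma HloadD u v : Hload (u + v) = Hload u + Hload v.
Proof. exact: bearing_loadD. Qed.

Lemma HloadZ t v : Hload (t *: v) = t * Hload v.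
Proof. exact: bearing_loadZ. Qed.

End Hform.

Section completion.
Context {R : realType} (B : bearing R).
Local Notation approx := (@Defs.approx R B).
Local Notation a := (@Hform R B).
Local Notation f := (@Hload R B).

(** Boundedness and coercivity compare the form with the square of [Hnorm], hence the thresholds
    sqrt(e / M) and m e^2. *)
Lemma form_cauchyP (s : nat -> Hspace B) :
  reflect (form_cauchy a s) (s \in @cauchy_pred R B).
Proof.
apply: (iffP (asboolP _)) => cs e e0.
- have [M M0 hM] := bearing_form_bounded B.
  have x0 : 0 < Num.sqrt (e / M) by rewrite sqrtr_gt0 divr_gt0.
  have [N hN] := cs _ x0; exists N => m n mN nN.
  apply: le_lt_trans (hM _) _; rewrite -ltr_pdivlMl// [_^-1 * e]mulrC.
  rewrite -(sqr_sqrtr (ltW (divr_gt0 e0 M0))).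
  by rewrite ltr_pXn2r ?nnegrE ?sqrtr_ge0//; exact: hN.
- have [m m0 hm] := bearing_form_coercive B.
  have x0 : 0 < m * e ^+ 2 by rewrite mulr_gt0// exprn_gt0.
  have [N hN] := cs _ x0; exists N => i j iN jN.
  have := le_lt_trans (hm _) (hN i j iN jN).
  by rewrite ltr_pM2l// ltr_pXn2r// ?nnegrE ?sqrtr_ge0// ltW.
Qed.

Lemma form_nullP (s : cauchyH B) :
  reflect (a (s n) (s n) @[n --> \oo] --> 0) (s \in @null_pred R B).
Proof.
apply: (iffP (asboolP _)) => s0.
- have [M M0 hM] := bearing_form_bounded B.
  apply: (@squeeze_cvgr _ _ _ _ (cst 0) (fun n => M * (Hnorm B (s n) * Hnorm B (s n)))).
  + by apply: nearW => n; rewrite Hform_ge0 -expr2 hM.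
  + exact: cvg_cst.
  + rewrite -(mulr0 M) -[X in M * X](mulr0 0).
    by apply: cvgM; [exact: cvg_cst|exact: cvgM].
- have [m m0 hm] := bearing_form_coercive B.
  apply/cvgr0Pnorm_le => e e0.
  have x0 : 0 < m * e ^+ 2 by rewrite mulr_gt0// exprn_gt0.
  have /cvgr0Pnorm_le/(_ _ x0) := s0; apply: filterS => n hn.
  rewrite ger0_norm ?sqrtr_ge0//.
  have := le_trans (hm (s n)) (le_trans (ler_norm _) hn).
  by rewrite ler_pM2l// ler_pXn2r// ?nnegrE ?sqrtr_ge0// ltW.
Qed.

Let pi_H (s : cauchyH B) : H100 B := \pi_{ideal_quot @null_pred R B}%qT s.

Implicit Types u v : H100 B.

Lemma approx_cauchy u : form_cauchy a (approx u).
Proof. by apply/form_cauchyP; rewrite /approx; case: (repr u). Qed.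

Lemma approx_pi (s : cauchyH B) : a (approx (pi_H s) n - s n)
  (approx (pi_H s) n - s n) @[n --> \oo] --> 0.
Proof.
have /form_nullP : repr (pi_H s) - s \in @null_pred R B.
  by rewrite Quotient.idealrBE reprK.
exact.
Qed.

Lemma H100_of_cauchy (s : cauchyH B) : exists u,
  a (approx u n - s n) (approx u n - s n) @[n --> \oo] --> 0.
Proof. by exists (pi_H s); exact: approx_pi. Qed.

(** The choice of representatives need not be additive, but the quotient map is: [repr v - repr u]
    represents [v - u]. *)
Lemma approxB u v :
  a (approx (v - u) n - (approx v n - approx u n))
    (approx (v - u) n - (approx v n - approx u n)) @[n --> \oo] --> 0.
Proof.
have := approx_pi (repr v - repr u).
have -> : pi_H (repr v - repr u) = v - u.
  by rewrite /pi_H raddfB /= !reprK.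
exact.
Qed.

Lemma approx_inj u v :
  a (approx u n - approx v n) (approx u n - approx v n) @[n --> \oo] --> 0 ->
  u = v.
Proof.
move=> h; have : repr u - repr v \in @null_pred R B by apply/form_nullP.
by rewrite Quotient.idealrBE => /eqP; rewrite !reprK.
Qed.

Lemma form_extE u v :
  form_ext u (v - u) = limn (fun n => a (approx u n) (approx v n - approx u n)).
Proof.
have cu := approx_cauchy u; have cv := approx_cauchy v.
have [aC aD] := (@HformC R B, @HformD R B).
have [aZ a0] := (@HformZ R B, @Hform_ge0 R B).
exact: (form_lim_equiv aC aD aZ a0 cu (form_cauchyB aC aD aZ a0 cv cu)
  (approxB u v)).
Qed.

Lemma load_extE u v :
  load_ext (v - u) = limn (fun n => f (approx v n - approx u n)).
Proof.
have [C f_le] := bearing_load_le B.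
have cu := approx_cauchy u; have cv := approx_cauchy v.
have [aC aD] := (@HformC R B, @HformD R B).
have [aZ a0] := (@HformZ R B, @Hform_ge0 R B).
exact: (load_lim_equiv aC aZ (@HloadD R B) (@HloadZ R B) f_le
  (form_cauchyB aC aD aZ a0 cv cu) (approxB u v)).
Qed.

Let tr (v : Hspace B) (z : measurableTypeR R * measurableTypeR R) : R :=
  v (jb_R2 B, z.1, z.2).

Let mC2 := @measurable_C2 R B.

Let measurable_tr (v : Hspace B) : measurable_fun (C2 B) (tr v).
Proof.
have [cv _ _ _] := H_continuous v.
apply/measurable_EFinP.
have h := @integrable_C2 R B (Hval v) cv.
exact: (measurable_int _ h).
Qed.

Let measurable_sqrB (g h : measurableTypeR R * measurableTypeR R -> R) :
  measurable_fun (C2 B) g -> measurable_fun (C2 B) h ->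
  measurable_fun (C2 B) (fun z => (g z - h z) ^+ 2).
Proof. by move=> mg mh; apply: measurable_funX; exact: measurable_funB. Qed.

Let integral_tr_sqr (v : Hspace B) :
  (\int[area R]_(z in C2 B) (tr v z ^+ 2)%:E =
  (\int[area R]_(z in C2 B) tr v z ^+ 2)%:E)%E.
Proof. by rewrite /Rintegral fineK//; exact: integrable_fin_num (integrable_trace_sqr v). Qed.

Let integral_neg_sqr (v : Hspace B) :
  (\int[area R]_(z in C2 B) (neg_trace v z ^+ 2)%:E = (neg_energy v)%:E)%E.
Proof.
rewrite /neg_energy /Rintegral fineK//.
exact: integrable_fin_num (integrable_neg_trace_sqr v).
Qed.

Lemma trace_L2_cvg (s : nat -> Hspace B) : form_cauchy a s ->
  exists2 g : measurableTypeR R * measurableTypeR R -> R,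
    measurable_fun (C2 B) g &
    (\int[area R]_(z in C2 B) ((tr (s n) z - g z) ^+ 2)%:E)%E
      @[n --> \oo] --> 0%E.
Proof.
move=> cs; apply: L2_cauchy_cvg => [|n|e e0]; [exact: mC2|exact: measurable_tr|].
have [K K0 hK] := trace_sqr_le B.
have eK : 0 < e / K by rewrite divr_gt0.
have [N hN] := cs _ eK; exists N => m n mN nN.
have -> : (\int[area R]_(z in C2 B) ((tr (s m) z - tr (s n) z) ^+ 2)%:E =
   \int[area R]_(z in C2 B) (tr (s m - s n) z ^+ 2)%:E)%E by [].
rewrite integral_tr_sqr lee_fin; apply: le_trans (hK _) _.
rewrite mulrC -ler_pdivlMr//; exact: ltW (hN _ _ mN nN).
Qed.

Let sqr_max0_le (x y : R) : (x - Num.max y 0) ^+ 2 <=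
  2 * Num.min x 0 ^+ 2 + 2 * (x - y) ^+ 2.
Proof.
have := sqr_ge0 (x - y); have := sqr_ge0 x; have := sqr_ge0 y.
have [hy|hy] := leP y 0; have [hx|hx] := leP x 0; rewrite ?subr0 ?expr0n/=; nra.
Qed.

Let min0_sqr_le (x y : R) : 0 <= y -> Num.min x 0 ^+ 2 <= (x - y) ^+ 2.
Proof.
by have [hx|hx] := leP x 0 => y0; rewrite ?expr0n ?sqr_ge0//; nra.
Qed.

Let sqr_le2 (x y : R) : y ^+ 2 <= 2 * x ^+ 2 + 2 * (x - y) ^+ 2.
Proof. have := sqr_ge0 (2 * x - y); nra. Qed.

Let measurable_neg_trace_sqr (v : Hspace B) :
  measurable_fun (C2 B) (fun z => neg_trace v z ^+ 2).
Proof.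
apply/measurable_EFinP.
exact: (measurable_int _ (integrable_neg_trace_sqr v)).
Qed.

Let sqr_dist_ge0 (s : nat -> Hspace B) g n :
  (0 <= \int[area R]_(z in C2 B) ((tr (s n) z - g z) ^+ 2)%:E)%E.
Proof. by apply: integral_ge0 => z _; rewrite lee_fin sqr_ge0. Qed.

(** Given a trace g >= 0, the pointwise bound min(x, 0)^2 <= (x - g)^2 dominates E by the squared
    L^2 distance to g. Conversely, the positive part of an L^2 limit of the restrictions is again a
    limit, by [sqr_max0_le]. *)
Lemma KsetP u : Kset u <-> neg_energy (approx u n) @[n --> \oo] --> 0.
Proof.
split=> [[g [mg _ gu] g0]|u0].
- have {}gu := (ge0_cvge0P (sqr_dist_ge0 (approx u) g)).1 gu.
  apply/cvgr0Pnorm_le => e e0; apply: filterS (gu _ e0) => n hn.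
  rewrite ger0_norm ?neg_energy_ge0// -lee_fin -integral_neg_sqr.
  apply: le_trans hn; apply: ae_ge0_le_integral => //.
  + by move=> z _; rewrite lee_fin sqr_ge0.
  + exact: (measurable_int _ (integrable_neg_trace_sqr (approx u n))).
  + by move=> z _; rewrite lee_fin sqr_ge0.
  + by apply/measurable_EFinP; exact: measurable_sqrB.
  + apply: filterS g0 => z g0 Cz; rewrite lee_fin.
    exact: min0_sqr_le (g0 Cz).
- have [g mg gu] := trace_L2_cvg (@approx_cauchy u).
  pose h z := Num.max (g z) 0.
  have mh : measurable_fun (C2 B) h by exact: measurable_maxr.
  exists h; last by apply: aeW => z _; rewrite le_max lexx orbT.
  have hu : (\int[area R]_(z in C2 B) ((tr (approx u n) z - h z) ^+ 2)%:E)%E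
      @[n --> \oo] --> 0%E.
    apply/(ge0_cvge0P (sqr_dist_ge0 (approx u) h)) => e e0.
    have e4 : 0 < e / 4 by rewrite divr_gt0.
    have {}gu := (ge0_cvge0P (sqr_dist_ge0 (approx u) g)).1 gu _ e4.
    move/cvgr0Pnorm_le : u0 => /(_ _ e4); apply: filterS2 gu => n gn un.
    apply: le_trans (ge0_le_integral2 (area R) mC2 (measurable_sqrB (measurable_tr _) mh)
      (measurable_neg_trace_sqr (approx u n))
      (measurable_sqrB (measurable_tr (approx u n)) mg) _ _ _ _) _.
    + by move=> z; exact: sqr_ge0.
    + by move=> z; exact: sqr_ge0.
    + by move=> z; exact: sqr_ge0.
    + by move=> z _; exact: sqr_max0_le.
    rewrite integral_neg_sqr.
    have -> : e%:E = (2%:E * (e / 4)%:E + 2%:E * (e / 4)%:E)%E.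
      by rewrite -!EFinM -EFinD; congr (_%:E); field.
    apply: leeD; apply: lee_wpmul2l; rewrite ?lee_fin//.
    exact: le_trans (ler_norm _) un.
  split=> //.
  (* Square integrability of h: one test function at squared distance at most 1 is enough. *)
  have [N _ /(_ N (leqnn N)) hN] := (ge0_cvge0P (sqr_dist_ge0 (approx u) h)).1 hu 1 ltr01.
  apply: le_lt_trans (ge0_le_integral2 (area R) mC2 _
      (measurable_funX 2 (measurable_tr (approx u N)))
      (measurable_sqrB (measurable_tr (approx u N)) mh) _ _ _ _) _.
  + exact: measurable_funX.
  + by move=> z; exact: sqr_ge0.
  + by move=> z; exact: sqr_ge0.
  + by move=> z; exact: sqr_ge0.
  + by move=> z _; exact: sqr_le2.
  rewrite integral_tr_sqr; apply: lte_add_pinfty.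
    by rewrite -EFinM ltry.
  by apply: lte_mul_pinfty => //; exact: le_lt_trans hN (ltry _).
Qed.

End completion.

(** * Existence and uniqueness of the weak solution *)

Theorem mainTheorem3 (R : realType) (B : bearing R) :
  exists! u : H100 B,
    Kset u /\
    forall v : H100 B, Kset v -> load_ext (v - u) <= form_ext u (v - u).
Proof.
have aC := @HformC R B; have aD := @HformD R B; have aZ := @HformZ R B.
have a_ge0 := @Hform_ge0 R B; have fD := @HloadD R B; have fZ := @HloadZ R B.
have [C f_le] := bearing_load_le B.
have E0 := @neg_energy_ge0 R B; have ED := @neg_energyD R B.
have EZ := @neg_energyZ R B.
have [s Es qs] := quasi_min_exists aC aZ fZ f_le E0 EZ.
have cs := quasi_min_cauchy aC aD aZ fD fZ ED EZ Es qs.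
have /form_cauchyP sP := cs.
have [u us] := H100_of_cauchy (CauchyH sP).
have cu := approx_cauchy u.
(* [form_ext] and [load_ext] are computed along the representative chosen for u, so the properties
   of s are moved to it. *)
have qu := quasi_min_equiv aC aD aZ a_ge0 fD fZ f_le cs us qs.
(* E of the difference is at most its squared trace norm, hence at most K times the form, which
   tends to 0. *)
have Eu : neg_energy (Defs.approx u n) @[n --> \oo] --> 0.
  have [K K0 hK] := trace_sqr_le B.
  apply: (@squeeze_cvgr _ _ _ _ (cst 0) (fun n => 2 * neg_energy (s n) +
    2 * (K * Hform (Defs.approx u n - s n) (Defs.approx u n - s n)))).
  - apply: nearW => n; rewrite E0/=.
    have := ED (s n) (Defs.approx u n - s n).
    rewrite addrC subrK => /le_trans; apply.
    rewrite lerD2l ler_pM2l//; apply: le_trans (neg_energy_le _) _.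
    exact: hK.
  - exact: cvg_cst.
  - have := cvgD (cvgM (cvg_cst (2 : R)) Es)
      (cvgM (cvg_cst (2 : R)) (cvgM (cvg_cst K) us)).
    by rewrite !mulr0 addr0; exact.
have var v : Kset v -> load_ext (v - u) <= form_ext u (v - u).
  move=> /KsetP Ev; rewrite form_extE load_extE.
  exact: (quasi_min_variational aC aD aZ a_ge0 fD fZ f_le E0 ED EZ Eu qu
    (approx_cauchy v) Ev).
exists u; split=> [|v [Kv hv]]; first by split; [exact/KsetP|].
apply: approx_inj; apply: (variational_unique aC aD aZ a_ge0 fD fZ f_le).
- exact: approx_cauchy.
- exact: approx_cauchy.
- by have := var v Kv; rewrite form_extE load_extE.
- by have := hv u ((KsetP u).2 Eu); rewrite form_extE load_extE.
Qed.
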